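(* Let $C\subset(\mathbb{R}^+)^2$ be a convex body with $\epsilon\Sigma\subset C\subset\delta\Sigma$ for some $\delta>\epsilon>0$, which is a lower set (for every $n\ge1$, whenever $(j_1,j_2)\in nC\cap\mathbb{N}^2$ we have $(k_1,k_2)\in nC\cap\mathbb{N}^2$ for all integers $0\le k_l\le j_l$, $l=1,2$). Suppose $(b,0)$ and $(0,a)$ are extreme points of $C$ ($a,b>0$) and that the outer face of $C$ (the part of the topological boundary of $C$ not lying on the coordinate axes) can be written both as a graph $\{(x,f(x)):0\le x\le b\}$ and as a graph $\{(g(y),y):0\le y\le a\}$. Let $E,F\subset\mathbb{C}$ be compact and $K=E\times F$. Then $$\delta_C(K)=D(E)^{A/(A+B)}\cdot D(F)^{B/(A+B)},\qquad A=\int_0^b uf(u)\,du,\quad B=\int_0^a ug(u)\,du,$$ where $D(E),D(F)$ are the univariate transfinite diameters of $E,F$. In particular, if $A=B$ then $\delta_C(K)=[D(E)D(F)]^{1/2}$.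
   Context: $\Sigma=\{(x,y):x,y\ge0,\ x+y\le1\}$. For $n\ge1$, $\mathrm{Poly}(nC)$ is the span of the monomials $z^J$, $J\in nC\cap\mathbb{N}^2$, with dimension $d_n$ and monomials $z^{\alpha(j)}$, $j=1,\dots,d_n$. Let $V_n(K)=\max_{\zeta_1,\dots,\zeta_{d_n}\in K}|\det[\zeta_j^{\alpha(i)}]_{i,j=1}^{d_n}|$ and $l_n=\sum_{j=1}^{d_n}|\alpha(j)|$. The $C$-transfinite diameter is $\delta_C(K)=\limsup_n V_n(K)^{1/l_n}$ (known to be a limit). *)

(* Defs.v *)
From HB Require Import structures.
From mathcomp Require Import all_boot all_order all_algebra.
From mathcomp Require Import all_classical all_reals all_analysis.
From mathcomp Require Import finmap.
From mathcomp.real_closed Require Import complex.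
Set Implicit Arguments. Unset Strict Implicit. Unset Printing Implicit Defensive.
Import Order.TTheory GRing.Theory Num.Theory.
Import numFieldNormedType.Exports.
Local Open Scope classical_set_scope.
Local Open Scope ring_scope.

Section Defs.
Variable R : realType.

Definition Sigma : set (R * R) :=
  [set p | 0 <= p.1 /\ 0 <= p.2 /\ p.1 + p.2 <= 1].

Definition scale_set (t : R) (S : set (R * R)) : set (R * R) :=
  [set (t * p.1, t * p.2) | p in S].

Definition quadrant : set (R * R) := [set p | 0 <= p.1 /\ 0 <= p.2].

Definition convex2 (C : set (R * R)) : Prop :=
  forall p q (t : R), C p -> C q -> 0 <= t <= 1 ->
    C (t * p.1 + (1 - t) * q.1, t * p.2 + (1 - t) * q.2).

Definition convex_body (C : set (R * R)) : Prop :=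
  compact C /\ convex2 C /\ interior C !=set0.

Definition extreme_point (C : set (R * R)) (p : R * R) : Prop :=
  C p /\ forall q r (t : R), C q -> C r -> 0 < t < 1 ->
    p = (t * q.1 + (1 - t) * r.1, t * q.2 + (1 - t) * r.2) -> q = r.

Definition top_boundary (C : set (R * R)) : set (R * R) :=
  closure C `\` interior C.

Definition outer_face (C : set (R * R)) : set (R * R) :=
  closure (top_boundary C `&` [set p | p.1 != 0 /\ p.2 != 0]).

Definition in_nC (C : set (R * R)) (n : nat) (J : nat * nat) : Prop :=
  C ((J.1)%:R / n%:R, (J.2)%:R / n%:R).

Definition lower_set (C : set (R * R)) : Prop :=
  forall n : nat, (1 <= n)%N -> forall j1 j2 : nat, in_nC C n (j1, j2) ->
    forall k1 k2 : nat, (k1 <= j1)%N -> (k2 <= j2)%N -> in_nC C n (k1, k2).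

Definition idxC (C : set (R * R)) (n : nat) : {fset (nat * nat)} :=
  fset_set [set J | in_nC C n J].
Definition dC (C : set (R * R)) (n : nat) : nat := #|` idxC C n|.
Definition alphaC (C : set (R * R)) (n : nat) (i : nat) : nat * nat :=
  nth (0%N, 0%N) (enum_fset (idxC C n)) i.

Definition cmod (z : R[i]) : R := Num.sqrt (complex.Re z ^+ 2 + complex.Im z ^+ 2).

Definition ccompact (E : set R[i]) : Prop := compact [set (complex.Re z, complex.Im z) | z in E].

Definition prodset (E F : set R[i]) : set (R[i] * R[i]) :=
  [set zeta | E zeta.1 /\ F zeta.2].

Definition vdmC (C : set (R * R)) (n : nat)
    (zeta : 'I_(dC C n) -> R[i] * R[i]) : R[i] :=
  \det (\matrix_(i < dC C n, j < dC C n)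
          ((zeta j).1 ^+ (alphaC C n i).1 * (zeta j).2 ^+ (alphaC C n i).2)).

Definition VC (C : set (R * R)) (K : set (R[i] * R[i])) (n : nat) : R :=
  sup [set cmod (vdmC zeta) | zeta in
        [set zeta : 'I_(dC C n) -> R[i] * R[i] | forall j, K (zeta j)]].

Definition lC (C : set (R * R)) (n : nat) : nat :=
  (\sum_(i < dC C n) ((alphaC C n i).1 + (alphaC C n i).2))%N.

Definition deltaC (C : set (R * R)) (K : set (R[i] * R[i])) : R :=
  limn_sup (fun n => VC C K n `^ ((lC C n)%:R)^-1).

Definition VD (E : set R[i]) (n : nat) : R :=
  sup [set cmod (\det (\matrix_(i < n.+1, j < n.+1) (z j) ^+ i)) | z in
        [set z : 'I_n.+1 -> R[i] | forall j, E (z j)]].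

Definition Dtd (E : set R[i]) : R :=
  limn_sup (fun n => VD E n `^ (('C(n.+1, 2))%:R)^-1).

End Defs.

(* Main.v *)
Require Import Defs.
From HB Require Import structures.
From mathcomp Require Import all_boot all_order all_algebra.
From mathcomp Require Import all_classical all_reals all_analysis.
From mathcomp Require Import measurable_realfun finmap.
From mathcomp.real_closed Require Import complex.
From mathcomp Require Import fingroup perm ring lra zify.
Set Implicit Arguments. Unset Strict Implicit. Unset Printing Implicit Defensive.
Import Order.TTheory GRing.Theory Num.Theory.
Import numFieldNormedType.Exports.
Local Open Scope classical_set_scope.
Local Open Scope ring_scope.

(* Since [C] is a lower set, the Vandermonde determinant does not change when each monomial z^i w^j is replaced by p_i(z) q_j(w) with p_i, q_j monic of degrees i, j. Polynomials p_i, q_j of almost minimal sup norm bound it above by d_n! prod ||p_i||_E ||q_j||_F; Newton polynomials at Leja-type points x_k in E, y_k in F, evaluated on the grid (x_i, y_j), make the matrix triangular and bound it below by the product of the Chebyshev numbers. Both bounds are governed by the Chebyshev constants, which coincide with D(E) and D(F) by the same two bounds in one variable, raised to the powers w1 = sum of i and w2 = sum of j over the lattice points of nC. Finally l_n = w1 + w2, w1 / n^3 -> A and w2 / n^3 -> B, because [C] is the region under the graph of [f] (and of [g]), so these are Riemann sums, while d_n!^(1/l_n) -> 1. *)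

(** * The modulus on [R[i]] and a crude bound for determinants *)

Section ComplexModulus.
Variable R : realType.
Implicit Types (z w : R[i]).

Lemma cmodE z : cmod z = Normc.normc z.
Proof. by case: z. Qed.

Lemma cmod_ge0 z : 0 <= cmod z.
Proof. exact: sqrtr_ge0. Qed.

Lemma cmodM z w : cmod (z * w) = cmod z * cmod w.
Proof. by rewrite !cmodE Normc.normcM. Qed.

Lemma cmod1 : cmod (1 : R[i]) = 1.
Proof. by rewrite cmodE Normc.normc1. Qed.

Lemma cmod0 : cmod (0 : R[i]) = 0.
Proof. by rewrite cmodE Normc.normc0. Qed.

Lemma cmodX z n : cmod (z ^+ n) = cmod z ^+ n.
Proof. by elim: n => [|n IH]; rewrite ?expr0 ?cmod1// !exprS cmodM IH. Qed.

Lemma cmodD_le z w : cmod (z + w) <= cmod z + cmod w.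
Proof. by rewrite !cmodE; exact: (@le_normcD R). Qed.

Lemma cmod_sign (b : bool) : cmod ((-1) ^+ b : R[i]) = 1.
Proof.
case: b; rewrite ?expr0 ?expr1 ?cmod1//.
by rewrite cmodE (normcN (1 : Rcomplex R)) Normc.normc1.
Qed.

Lemma cmod_prod I (r : seq I) (P : pred I) (F : I -> R[i]) :
  cmod (\prod_(i <- r | P i) F i) = \prod_(i <- r | P i) cmod (F i).
Proof. exact: (big_morph _ cmodM cmod1). Qed.

Lemma cmod_sum_le I (r : seq I) (P : pred I) (F : I -> R[i]) :
  cmod (\sum_(i <- r | P i) F i) <= \sum_(i <- r | P i) cmod (F i).
Proof.
elim/big_ind2: _ => [|x1 x2 y1 y2 h1 h2|//]; first by rewrite cmod0.
by rewrite (le_trans (cmodD_le _ _))// lerD.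
Qed.

(** Each of the [d!] Leibniz terms takes one entry from every row. The factor [d!] is harmless
    because its root of order [l_n] tends to 1. *)
Lemma cmod_det_le d (M : 'M[R[i]]_d) (c : 'I_d -> R) :
  (forall i j, cmod (M i j) <= c i) -> cmod (\det M) <= (d`!)%:R * \prod_i c i.
Proof.
move=> Mc; rewrite /determinant; apply: le_trans (cmod_sum_le _ _ _) _.
have -> : (d`!)%:R * \prod_i c i = \sum_(s : 'S_d) \prod_i c i.
  by rewrite sumr_const card_Sn mulr_natl.
apply: ler_sum => s _; rewrite cmodM cmod_sign mul1r cmod_prod.
by apply: ler_prod => i _; rewrite cmod_ge0 Mc.
Qed.

End ComplexModulus.

(* A permutation that contributes to the Leibniz sum cannot increase [r]; as it preserves the sum of [r], it preserves [r] itself. *)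
Lemma det_rank_triangular (K : comNzRingType) d (U : 'M[K]_d) (r : 'I_d -> nat) :
  (forall i k, k != i -> (r i <= r k)%N -> U i k = 0) ->
  \det U = \prod_i U i i.
Proof.
move=> U0; rewrite /determinant (bigD1 1%g)//= odd_perm1 expr0 mul1r.
rewrite [X in _ + X]big1 ?addr0; last first.
  move=> s s1; have [i /andP[si ri]] : exists i, (s i != i) && (r i <= r (s i))%N.
    apply/existsP; apply: contraNT s1 => /existsPn h.
    have le_rs i : (r (s i) <= r i)%N.
      by have := h i; case: (eqVneq (s i) i) => [->//|_]; rewrite /= -ltnNge => /ltnW.
    have : (\sum_i r i = \sum_i r (s i))%N by rewrite (reindex_inj (@perm_inj _ s)).
    move=> eq_sum; apply/eqP/permP => i; rewrite perm1; apply/eqP.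
    apply/negPn/negP => si; have := h i; rewrite si /= -ltnNge => lt_rs.
    move: eq_sum; rewrite (bigD1 i)//= [in RHS](bigD1 i)//= => eq_sum.
    have : (\sum_(j | j != i) r (s j) <= \sum_(j | j != i) r j)%N by apply: leq_sum.
    by move: eq_sum; set X := bigop.body _ _ _; set Y := bigop.body _ _ _; lia.
  by rewrite (bigD1 i)//= U0// mul0r mulr0.
by apply: eq_bigr => i _; rewrite perm1.
Qed.

(** * Monic changes of basis in generalized Vandermonde determinants *)

Definition lower_family d (al : 'I_d -> nat * nat) : Prop :=
  forall i k1 k2, (k1 <= (al i).1)%N -> (k2 <= (al i).2)%N ->
    exists j, al j = (k1, k2).

(** The expansion of [p_i(z) q_j(w)] involves only monomials below [(i, j)], all present in a lower
    family. The coefficient matrix is triangular for the total degree with unit diagonal, so its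
    determinant is 1. *)
Lemma det_monic_change (K : comNzRingType) d (al : 'I_d -> nat * nat)
    (p q : nat -> {poly K}) (z : 'I_d -> K * K) :
  injective al -> lower_family al ->
  (forall k, p k \is monic /\ size (p k) = k.+1) ->
  (forall k, q k \is monic /\ size (q k) = k.+1) ->
  \det (\matrix_(i, j) ((z j).1 ^+ (al i).1 * (z j).2 ^+ (al i).2)) =
  \det (\matrix_(i, j) ((p (al i).1).[(z j).1] * (q (al i).2).[(z j).2])).
Proof.
move=> ial lal hp hq.
pose U := \matrix_(i < d, k < d) ((p (al i).1)`_(al k).1 * (q (al i).2)`_(al k).2).
set M := \matrix_(_, _) _; set N := \matrix_(_, _) _.
have -> : N = U *m M.
  apply/matrixP => i j; rewrite !mxE.
  rewrite !horner_coef (hp _).2 (hq _).2 big_distrlr/=.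
  under [RHS]eq_bigr do rewrite !mxE.
  rewrite pair_big/=.
  (* [h] locates in the family each exponent of the rectangle below [al i], which turns the product
     of two expansions into a sum over the family. *)
  have [h hE] : exists h : 'I_(al i).1.+1 * 'I_(al i).2.+1 -> 'I_d,
      forall u, al (h u) = (nat_of_ord u.1, nat_of_ord u.2).
    suff /boolp.choice[h hE] : forall u : 'I_(al i).1.+1 * 'I_(al i).2.+1, exists k, al k = (nat_of_ord u.1, nat_of_ord u.2) by exists h.
    move=> u.
    by apply: (lal i); rewrite -ltnS.
  rewrite [RHS](bigID (fun k => ((al k).1 < (al i).1.+1) && ((al k).2 < (al i).2.+1))%N)/=.
  (* Outside the rectangle, one of the two coefficients has an index beyond the size of its
     polynomial. *)
  rewrite [X in _ = _ + X]big1 ?addr0; last first.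
    move=> k; rewrite negb_and -!leqNgt => /orP[] hk.
      by rewrite (nth_default _ (s := p _)) ?(hp _).2// !mul0r.
    by rewrite (nth_default _ (s := q _)) ?(hq _).2// mulr0 mul0r.
  rewrite [RHS](reindex h)/=; last first.
    exists (fun k => (inord (al k).1, inord (al k).2)) => [u _|k].
      by rewrite hE /= !inord_val; case: u.
    rewrite inE => /andP[k1 k2]; apply: ial; rewrite hE/= !inordK//.
    by case: (al k).
  rewrite [RHS](eq_bigl xpredT); last by move=> u; rewrite hE /= !ltn_ord.
  by apply: eq_bigr => u _; rewrite hE /=; ring.
rewrite det_mulmx (@det_rank_triangular _ _ U (fun i => (al i).1 + (al i).2)%N).
  rewrite big1 ?mul1r// => i _; rewrite mxE.
  have := (hp (al i).1).1; have := (hq (al i).2).1.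
  by rewrite !monicE !lead_coefE (hp _).2 (hq _).2 /= => /eqP -> /eqP ->; rewrite mulr1.
(* A nonzero entry forces [al k] below [al i] in both coordinates; as its total degree is not
   smaller, the exponents agree, and injectivity gives [k = i]. *)
move=> i k ki le_ik; rewrite mxE.
have [h1|h1] := ltnP (al i).1 (al k).1.
  by rewrite (nth_default _ (s := p _)) ?(hp _).2// mul0r.
have [h2|h2] := ltnP (al i).2 (al k).2.
  by rewrite (nth_default _ (s := q _)) ?(hq _).2// mulr0.
case/eqP: ki; apply: ial; move: h1 h2 le_ik.
by case: (al i) (al k) => [? ?] [? ?] /= *; congr pair; lia.
Qed.

Definition newton (K : comNzRingType) (x : nat -> K) (k : nat) : {poly K} :=
  \prod_(m < k) ('X - (x m)%:P).

Lemma newton_monic (K : idomainType) (x : nat -> K) k :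
  newton x k \is monic /\ size (newton x k) = k.+1.
Proof.
by rewrite /newton monic_prod_XsubC size_prod_XsubC /index_enum -enumT size_enum_ord.
Qed.

Lemma horner_newton (K : comNzRingType) (x : nat -> K) k y :
  (newton x k).[y] = \prod_(m < k) (y - x m).
Proof. by rewrite horner_prod; apply: eq_bigr => m _; rewrite hornerXsubC. Qed.

Lemma horner_newton0 (K : comNzRingType) (x : nat -> K) k m :
  (m < k)%N -> (newton x k).[x m] = 0.
Proof.
by move=> mk; rewrite horner_newton (bigD1 (Ordinal mk))//= subrr mul0r.
Qed.

(** In the Newton bases, entry [(i, j)] vanishes as soon as one coordinate of [al j] is smaller than
    that of [al i]. The transposed matrix is thus triangular for the total degree. *)
Lemma det_newton_grid (K : idomainType) d (al : 'I_d -> nat * nat) (x y : nat -> K) :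
  injective al -> lower_family al ->
  \det (\matrix_(i, j) (x (al j).1 ^+ (al i).1 * y (al j).2 ^+ (al i).2)) =
  \prod_i ((newton x (al i).1).[x (al i).1] * (newton y (al i).2).[y (al i).2]).
Proof.
move=> ial lal.
have := @det_monic_change _ _ al _ _ (fun j => (x (al j).1, y (al j).2)) ial lal
  (newton_monic x) (newton_monic y).
move=> /= ->; rewrite -det_tr.
rewrite (@det_rank_triangular _ _ _ (fun i => (al i).1 + (al i).2)%N).
  by apply: eq_bigr => i _; rewrite !mxE.
move=> i k ki le_ik; rewrite !mxE.
have [h1|h1] := ltnP (al i).1 (al k).1; first by rewrite horner_newton0// mul0r.
have [h2|h2] := ltnP (al i).2 (al k).2.
  by rewrite [X in _ * X]horner_newton0// mulr0.
case/eqP: ki; apply: ial; move: h1 h2 le_ik.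
by case: (al i) (al k) => [? ?] [? ?] /= *; congr pair; lia.
Qed.

(** * Chebyshev constants and two-sided bounds for Vandermonde determinants *)

Section ChebyshevConstant.
Variable R : realType.
Implicit Types (E F : set R[i]) (c : R).

(** Upper bounds for the [k]-th root of the sup norm on [E] of a monic polynomial of degree [k > 0],
    phrased without roots or suprema. On an empty [E] every positive number qualifies. *)
Definition cheb_rates E : set R :=
  [set c | 0 < c /\ exists (k : nat) (p : {poly R[i]}),
    [/\ (0 < k)%N, p \is monic, size p = k.+1 & forall x, E x -> cmod p.[x] <= c ^+ k]].

(** The Chebyshev constant of [E], taken as an infimum over all degrees instead of a limit. *)
Definition cheb E : R := inf (cheb_rates E).

Definition cbounded E := exists2 rho : R, 0 < rho & forall x, E x -> cmod x <= rho.

Lemma cheb_rates_lb E : lbound (cheb_rates E) 0.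
Proof. by move=> c [/ltW]. Qed.

Lemma cheb_ge0 E : 0 <= cheb E.
Proof.
rewrite /cheb; have [->|/set0P h0] := eqVneq (cheb_rates E) set0; first by rewrite inf0.
by apply: lb_le_inf => //; exact: cheb_rates_lb.
Qed.

Lemma cheb_le E c : cheb_rates E c -> cheb E <= c.
Proof. by apply: ge_inf; exists 0; exact: cheb_rates_lb. Qed.

Lemma cheb_rates_nonempty E : cbounded E -> cheb_rates E !=set0.
Proof.
move=> [rho rho0 hE]; exists rho; split=> //; exists 1%N, 'X; split=> //.
- exact: monicX.
- by rewrite size_polyX.
- by move=> x Ex; rewrite hornerX expr1 hE.
Qed.

Definition monic_family (p : nat -> {poly R[i]}) :=
  forall k, p k \is monic /\ size (p k) = k.+1.

(* Write [i = q k + r] and use ['X^r * p^q], where [p] has degree [k] and rate below [c]. *)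
Lemma cheb_monic_family E c : cbounded E -> cheb E < c ->
  exists M p, [/\ 1 <= M, monic_family p &
    forall k x, E x -> cmod (p k).[x] <= M * c ^+ k].
Proof.
move=> bE Dc; have [rho rho0 hE] := bE.
have [c' [c'0 [k [p [k0 mp sp hp]]]] c'c] := inf_lt (cheb_rates_nonempty bE) Dc.
have c0 : 0 < c := lt_trans c'0 c'c.
(* [t] pays for the leftover factor ['X^r]: [|x| <= rho <= t c] on [E], and [r < k] makes [t^k] a
   constant independent of the degree. *)
pose t := Num.max 1 (rho / c); have t1 : 1 <= t by rewrite /t le_max lexx.
exists (t ^+ k), (fun i => 'X^(i %% k) * p ^+ (i %/ k)); split.
- by rewrite exprn_ege1.
- move=> i; have m1 : 'X^(i %% k) * p ^+ (i %/ k) \is monic.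
    by rewrite monicMl ?monicXn// monic_exp.
  split=> //; rewrite size_monicM ?monicXn ?monic_neq0 ?monic_exp//.
  have sq : (size (p ^+ (i %/ k)) = (k * (i %/ k)).+1)%N.
    have : (0 < size (p ^+ (i %/ k)))%N by rewrite size_poly_gt0 monic_neq0 ?monic_exp.
    by case: size (size_exp p (i %/ k)) => //= m; rewrite sp /= => <-.
  by rewrite size_polyXn sq addSn /= addnS addnC mulnC -divn_eq.
- move=> i x Ex; rewrite hornerM hornerXn horner_exp cmodM !cmodX.
  have i1 : c ^+ i = c ^+ (i %% k) * (c ^+ k) ^+ (i %/ k).
    by rewrite -exprM -exprD addnC mulnC -divn_eq.
  rewrite i1 mulrA ler_pM ?exprn_ge0 ?cmod_ge0//.
    rewrite (le_trans (_ : _ <= (t * c) ^+ (i %% k)))//.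
      rewrite lerXn2r ?nnegrE ?cmod_ge0//; first by rewrite mulr_ge0 ?ltW// (lt_le_trans _ t1).
      by rewrite (le_trans (hE _ Ex))// -ler_pdivrMr// le_max lexx orbT.
    rewrite exprMn; apply: ler_wpM2r; first exact: exprn_ge0 (ltW c0).
    apply: ler_weXn2l => //.
    by rewrite ltnW// ltn_mod.
  rewrite lerXn2r ?nnegrE ?cmod_ge0 ?exprn_ge0 ?(ltW c0)//.
  by rewrite (le_trans (hp _ Ex))// lerXn2r ?nnegrE ?(ltW c0) ?(ltW c'0) ?(ltW c'c).
Qed.

(** If no such point existed, the monic polynomial with root list [s] would stay below [c ^+ size s]
    on [E], making [c] an admissible rate against [c < cheb E]. *)
Lemma cheb_far_point E c (s : seq R[i]) : 0 < c -> c < cheb E ->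
  exists2 y, E y & c ^+ size s <= cmod (\prod_(m <- s) (y - m)).
Proof.
move=> c0 cD; apply: contrapT => /forall2NP h; move: cD; rewrite ltNge => /negP; apply.
apply: cheb_le; split=> //; case: s h => [|a s] h.
  (* Degree 0 is excluded from [cheb_rates]. For the empty list the negation says that [E] is empty,
     so ['X] works vacuously. *)
  exists 1%N, 'X; split; rewrite ?monicX ?size_polyX// => x Ex.
  by have [//|] := h x; rewrite big_nil cmod1 expr0 lexx.
exists (size (a :: s)), (\prod_(m <- a :: s) ('X - m%:P)); split=> //.
- exact: monic_prod_XsubC.
- by rewrite size_prod_XsubC.
- move=> x Ex; have [//|/negP] := h x; rewrite -ltNge => /ltW.
  rewrite horner_prod; congr (cmod _ <= _).
  by apply: eq_bigr => m _; rewrite hornerXsubC.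
Qed.

(** Greedy choice in the manner of Leja: each point comes from [cheb_far_point] applied to the list
    of its predecessors, the bound [c ^+ k] replacing an exact maximum. *)
Lemma cheb_leja_points E c : 0 < c -> c < cheb E ->
  exists x : nat -> R[i], (forall k, E (x k)) /\
    forall k, c ^+ k <= cmod (newton x k).[x k].
Proof.
move=> c0 cD.
suff /boolp.choice[next hn] : forall s : seq R[i],
    exists y, E y /\ c ^+ size s <= cmod (\prod_(m <- s) (y - m)).
  pose pts := fix pts n := if n is m.+1 then rcons (pts m) (next (pts m)) else [::].
  have ptsE n : pts n = mkseq (fun k => next (pts k)) n.
    by elim: n => // n IH; rewrite /= {1}IH -mkseqS.
  exists (fun k => next (pts k)); split=> k; first exact: (hn _).1.
  have := (hn (pts k)).2; rewrite horner_newton.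
  have -> : size (pts k) = k by rewrite ptsE size_mkseq.
  by rewrite [in X in \prod_(_ <- X) _]ptsE big_map -[k in iota 0 k]subn0 big_mkord.
by move=> s; have [y] := cheb_far_point s c0 cD; exists y.
Qed.

(** [cmod_det_le] is applied after passing to monic polynomials of almost minimal norm. [M] is
    chosen before [d], [al] and [z], so one constant serves all [n]. *)
Lemma vandermonde_upper E F c1 c2 : cbounded E -> cbounded F ->
  cheb E < c1 -> cheb F < c2 ->
  exists2 M : R, 1 <= M & forall d (al : 'I_d -> nat * nat) (z : 'I_d -> R[i] * R[i]),
    injective al -> lower_family al -> (forall j, E (z j).1 /\ F (z j).2) ->
    cmod (\det (\matrix_(i, j) ((z j).1 ^+ (al i).1 * (z j).2 ^+ (al i).2))) <=
    (d`!)%:R * M ^+ d *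
      (c1 ^+ (\sum_i (al i).1)%N * c2 ^+ (\sum_i (al i).2)%N).
Proof.
move=> bE bF D1 D2.
have [M1 [p [M11 mp hp]]] := cheb_monic_family bE D1.
have [M2 [q [M21 mq hq]]] := cheb_monic_family bF D2.
have c10 : 0 <= c1 by rewrite (le_trans (cheb_ge0 E)) ?ltW.
have c20 : 0 <= c2 by rewrite (le_trans (cheb_ge0 F)) ?ltW.
exists (M1 * M2); first by rewrite mulr_ege1.
move=> d al z ial lal hz; rewrite (det_monic_change _ ial lal mp mq).
apply: le_trans (cmod_det_le (c := fun i =>
  (M1 * c1 ^+ (al i).1) * (M2 * c2 ^+ (al i).2)) _) _.
  move=> i j; rewrite !mxE cmodM ler_pM ?cmod_ge0//.
    by apply: hp; have [] := hz j.
  by apply: hq; have [] := hz j.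
rewrite -mulrA ler_wpM2l ?ler0n// !big_split/= !prodr_const !card_ord.
by rewrite -!expr_sum exprMn le_eqVlt; apply/orP; left; apply/eqP; ring.
Qed.

(** On the grid of Leja-type points the determinant is a product of Newton values, each bounded
    below by a power of [c1] or [c2]. *)
Lemma vandermonde_lower E F c1 c2 : 0 < c1 -> 0 < c2 ->
  c1 < cheb E -> c2 < cheb F ->
  forall d (al : 'I_d -> nat * nat), injective al -> lower_family al ->
  exists2 z : 'I_d -> R[i] * R[i], (forall j, E (z j).1 /\ F (z j).2) &
    c1 ^+ (\sum_i (al i).1)%N * c2 ^+ (\sum_i (al i).2)%N <=
    cmod (\det (\matrix_(i, j) ((z j).1 ^+ (al i).1 * (z j).2 ^+ (al i).2))).
Proof.
move=> c10 c20 D1 D2 d al ial lal.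
have [x [Ex hx]] := cheb_leja_points c10 D1.
have [y [Fy hy]] := cheb_leja_points c20 D2.
exists (fun j => (x (al j).1, y (al j).2)); first by move=> j /=; split; [exact: Ex|exact: Fy].
rewrite (det_newton_grid x y ial lal) cmod_prod !expr_sum -big_split/=.
apply: ler_prod => i _; apply/andP; split.
  by rewrite mulr_ge0 ?exprn_ge0 ?(ltW c10) ?(ltW c20).
by rewrite cmodM; apply: ler_pM; rewrite ?exprn_ge0 ?(ltW c10) ?(ltW c20).
Qed.
End ChebyshevConstant.

(** * Limits of roots of sandwiched sequences *)

Section RootSandwich.
Variable R : realType.
Implicit Types (c e th : R).

Lemma cvg_powR_exponent c (t : nat -> R) th : 0 < c ->
  t n @[n --> \oo] --> th -> c `^ t n @[n --> \oo] --> c `^ th.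
Proof.
move=> c0 tth; rewrite /powR gt_eqF//.
by apply: continuous_cvg; [exact: continuous_expR|exact: cvgMl].
Qed.

Lemma powR_expn c (m l : nat) : 0 <= c ->
  (c ^+ m) `^ (l%:R^-1) = c `^ (m%:R / l%:R).
Proof. by move=> c0; rewrite -powR_mulrn// -powRrM. Qed.

(** Write [c] as the square of its root and use that [ln] is sublinear. This gives
    [ln n / n = O(n^(-1/2))], enough for the factorial factor. *)
Lemma ln_le_sqrt c : 0 < c -> ln c <= 2 * Num.sqrt c.
Proof.
move=> c0; rewrite -{1}(sqr_sqrtr (ltW c0)) lnXn ?sqrtr_gt0// -[_ *+ 2]mulr_natl.
by rewrite ler_pM2l// ltW// ln_sublinear// sqrtr_gt0.
Qed.

Lemma cvg_invn : (n%:R^-1 : R) @[n --> \oo] --> (0 : R).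
Proof. by apply/gtr0_cvgV0; [exact: nbhs_infty_gtr|exact: cvgr_idn]. Qed.

(* Here [d = O(n^2)] and [l >= n d / K], so that [ln (d! M^d) / l = O(ln n / n)]. *)
Lemma factor_root_le (K M : R) (n d l : nat) : 1 <= K -> 1 <= M -> (0 < n)%N -> (0 < l)%N ->
  d%:R <= K * n%:R ^+ 2 -> n%:R * d%:R <= K * l%:R ->
  ((d`!)%:R * M ^+ d) `^ (l%:R^-1) <=
  expR (K * (ln K + ln M) * n%:R^-1 + 4 * K * Num.sqrt (n%:R^-1)).
Proof.
move=> K1 M1 n0 l0 dK ndK.
have K0 : 0 < K := lt_le_trans ltr01 K1.
have M0 : 0 < M := lt_le_trans ltr01 M1.
have n0' : 0 < n%:R :> R by rewrite ltr0n.
have l0' : 0 < l%:R :> R by rewrite ltr0n.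
have lnK : 0 <= ln K by rewrite ln_ge0.
have lnM0 : 0 <= ln M by rewrite ln_ge0.
(* Each of the [d] factors of [d!] is at most [d <= K n^2]. *)
have fd : ((d`!)%:R : R) <= (K * n%:R ^+ 2) ^+ d.
  elim: d dK {ndK} => [|d IH] dK; first by rewrite fact0 expr0.
  rewrite factS exprS natrM ler_pM//.
  by apply: IH; apply: le_trans dK; rewrite ler_nat.
have Kn0 : 0 < K * n%:R ^+ 2 by rewrite mulr_gt0 ?exprn_gt0.
have B0 : 0 < K * n%:R ^+ 2 * M by rewrite mulr_gt0.
apply: (@le_trans _ _ (((K * n%:R ^+ 2 * M) ^+ d) `^ (l%:R^-1))).
  apply: ge0_ler_powR; rewrite ?nnegrE ?invr_ge0 ?ler0n//.
  - by rewrite mulr_ge0 ?ler0n ?exprn_ge0 ?(ltW M0).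
  - by rewrite exprn_ge0 ?(ltW B0).
  - by rewrite [leRHS]exprMn ler_wpM2r ?exprn_ge0 ?(ltW M0).
rewrite powR_expn ?(ltW B0)// /powR gt_eqF// ler_expR.
have -> : ln (K * n%:R ^+ 2 * M) = ln K + ln n%:R *+ 2 + ln M.
  by rewrite lnM ?posrE// lnM ?posrE ?exprn_gt0// lnXn.
have lnn : ln (n%:R : R) <= 2 * Num.sqrt n%:R by exact: ln_le_sqrt.
have lnn0 : 0 <= ln (n%:R : R) by rewrite ln_ge0// ler1n.
apply: (@le_trans _ _ (K / n%:R * (ln K + ln n%:R *+ 2 + ln M))).
  rewrite ler_wpM2r//; first by rewrite !addr_ge0 ?mulrn_wge0.
  by rewrite ler_pdivrMr// mulrAC ler_pdivlMr// mulrC.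
have sq : Num.sqrt n%:R / n%:R = Num.sqrt (n%:R^-1) :> R.
  rewrite sqrtrV ?ler0n// -{2}(sqr_sqrtr (ltW n0')) expr2 invfM mulrA divff ?mul1r//.
  by rewrite gt_eqF// sqrtr_gt0.
rewrite -sq -subr_ge0.
have -> : K * (ln K + ln M) / n%:R + 4 * K * (Num.sqrt n%:R / n%:R) -
   K / n%:R * (ln K + ln n%:R *+ 2 + ln M) =
   2 * (K / n%:R) * (2 * Num.sqrt n%:R - ln n%:R) by ring.
by rewrite mulr_ge0 ?subr_ge0// mulr_ge0// divr_ge0 ?ltW.
Qed.

Lemma factor_root_cvg (K M : R) :
  expR (K * (ln K + ln M) * n%:R^-1 + 4 * K * Num.sqrt (n%:R^-1)) @[n --> \oo] --> (1 : R).
Proof.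
have h : K * (ln K + ln M) * n%:R^-1 + 4 * K * Num.sqrt (n%:R^-1) @[n --> \oo] -->
    K * (ln K + ln M) * 0 + 4 * K * Num.sqrt (0 : R).
  apply: cvgD; apply: cvgM; try exact: cvg_cst; first exact: cvg_invn.
  by apply: continuous_cvg; [exact: sqrt_continuous|exact: cvg_invn].
rewrite sqrtr0 !mulr0 addr0 in h.
have := continuous_cvg _ (@continuous_expR R 0) h.
rewrite expR0 => h2; exact: h2.
Qed.

Lemma powR_mean_approx0 c2 th e : 0 < th -> 0 < c2 -> 0 < e ->
  exists2 c1, 0 < c1 & c1 `^ th * c2 < e.
Proof.
move=> th0 c20 e0; exists ((e / 2 / c2) `^ th^-1); first by rewrite powR_gt0// !divr_gt0.
rewrite -powRrM mulVf ?gt_eqF// powRr1 ?divfK ?gt_eqF//; last by rewrite !divr_ge0 ?ltW.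
by rewrite ltr_pdivrMr// ltr_pMr// ltr1n.
Qed.

Lemma powR_mean_scale (D1 D2 th s : R) : 0 < D1 -> 0 < D2 -> 0 < s ->
  (D1 * s) `^ th * (D2 * s) `^ (1 - th) = D1 `^ th * D2 `^ (1 - th) * s.
Proof.
move=> D10 D20 s0; have es : s `^ th * s `^ (1 - th) = s.
  rewrite -powRD ?(gt_eqF s0) ?implybT// addrC subrK powRr1//.
  exact: ltW.
rewrite !powRM ?(ltW D10) ?(ltW D20) ?(ltW s0)//.
by rewrite -[in RHS]es; ring.
Qed.

(** If both numbers are positive, they are enlarged by a common factor. If one is zero with a
    positive exponent, the other is raised by 1 and the first is then chosen so small that the
    product stays below [e]. *)
Lemma powR_mean_approx (D1 D2 th e : R) : 0 <= D1 -> 0 <= D2 ->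
  (0 < D1 /\ 0 < D2) \/ (D1 = 0 /\ 0 < th) \/ (D2 = 0 /\ th < 1) -> 0 < e ->
  exists c1 c2, [/\ D1 < c1, D2 < c2 &
    c1 `^ th * c2 `^ (1 - th) < D1 `^ th * D2 `^ (1 - th) + e].
Proof.
move=> D10 D20 hyp e0.
have pos c : 0 <= c -> 0 < c + 1 by move=> c0; rewrite ltr_wpDl.
case: hyp => [[D1p D2p]|[[D1E th0]|[D2E th1]]].
- pose L := D1 `^ th * D2 `^ (1 - th).
  have L0 : 0 < L by rewrite mulr_gt0 ?powR_gt0.
  have s1 : 1 < 1 + e / (2 * L) by rewrite ltrDl divr_gt0// mulr_gt0.
  have s0 : 0 < 1 + e / (2 * L) := lt_trans ltr01 s1.
  exists (D1 * (1 + e / (2 * L))), (D2 * (1 + e / (2 * L))).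
  split; rewrite ?ltr_pMr// powR_mean_scale// -/L mulrDr mulr1 ltrD2l.
  have -> : L * (e / (2 * L)) = e / 2 by field; rewrite gt_eqF.
  by lra.
- have K0 : 0 < (D2 + 1) `^ (1 - th) by rewrite powR_gt0 ?pos.
  have [c1 c10 hc] := powR_mean_approx0 th0 K0 e0.
  exists c1, (D2 + 1); rewrite D1E ltrDl ltr01 powR0 ?gt_eqF// mul0r add0r.
  by split.
- have K0 : 0 < (D1 + 1) `^ th by rewrite powR_gt0 ?pos.
  have th1' : 0 < 1 - th by rewrite subr_gt0.
  have [c2 c20 hc] := powR_mean_approx0 th1' K0 e0.
  exists (D1 + 1), c2; rewrite D2E ltrDl ltr01 (powR0 (x := 1 - th)) ?gt_eqF// mulr0 add0r mulrC.
  by split.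
Qed.

(** The bounds hold for all [c1], [c2] on either side of [D1], [D2], and the root of [d! M^d] tends
    to 1. The growth conditions start beyond [N] because [w1 n + w2 n] may vanish for small [n]. *)
Lemma root_sandwich (V : nat -> R) (d w1 w2 : nat -> nat) (D1 D2 th K : R) (N : nat) :
  0 <= D1 -> 0 <= D2 ->
  (0 < D1 /\ 0 < D2) \/ (D1 = 0 /\ 0 < th) \/ (D2 = 0 /\ th < 1) ->
  1 <= K ->
  (forall n, (N < n)%N -> [/\ 0 <= V n, (0 < w1 n + w2 n)%N,
     (d n)%:R <= K * n%:R ^+ 2 & n%:R * (d n)%:R <= K * (w1 n + w2 n)%:R]) ->
  (forall c1 c2, 0 < c1 -> 0 < c2 -> c1 < D1 -> c2 < D2 ->
     forall n, (0 < n)%N -> c1 ^+ w1 n * c2 ^+ w2 n <= V n) ->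
  (forall c1 c2, D1 < c1 -> D2 < c2 -> exists2 M, 1 <= M &
     forall n, (0 < n)%N ->
       V n <= ((d n)`!)%:R * M ^+ d n * (c1 ^+ w1 n * c2 ^+ w2 n)) ->
  ((w1 n)%:R / (w1 n + w2 n)%:R : R) @[n --> \oo] --> th ->
  V n `^ ((w1 n + w2 n)%:R^-1) @[n --> \oo] --> D1 `^ th * D2 `^ (1 - th).
Proof.
move=> D10 D20 hyp K1 hn lower upper w1th.
set L := _ * _ `^ (1 - th).
have w2th : ((w2 n)%:R / (w1 n + w2 n)%:R : R) @[n --> \oo] --> 1 - th.
  apply: (@cvg_trans _ ((1 - (w1 n)%:R / (w1 n + w2 n)%:R : R) @[n --> \oo])).
    apply: near_eq_cvg; near=> n.
    have [_ l0 _ _] : [/\ 0 <= V n, (0 < w1 n + w2 n)%N,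
     (d n)%:R <= K * n%:R ^+ 2 & n%:R * (d n)%:R <= K * (w1 n + w2 n)%:R].
      by apply: hn; near: n; exact: nbhs_infty_gt.
    have l0' : (w1 n + w2 n)%:R != 0 :> R by rewrite pnatr_eq0 -lt0n.
    by rewrite -{1}(divff l0') -mulrBl natrD addrAC subrr add0r.
  by apply: cvgB => //; exact: cvg_cst.
have cvgG c1 c2 : 0 < c1 -> 0 < c2 ->
    c1 `^ ((w1 n)%:R / (w1 n + w2 n)%:R) * c2 `^ ((w2 n)%:R / (w1 n + w2 n)%:R)
      @[n --> \oo] --> c1 `^ th * c2 `^ (1 - th).
  by move=> c10 c20; apply: cvgM; exact: cvg_powR_exponent.
have rootG c1 c2 n : 0 < c1 -> 0 < c2 ->
    (c1 ^+ w1 n * c2 ^+ w2 n) `^ ((w1 n + w2 n)%:R^-1) =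
    c1 `^ ((w1 n)%:R / (w1 n + w2 n)%:R) * c2 `^ ((w2 n)%:R / (w1 n + w2 n)%:R).
  move=> c10 c20; rewrite powRM ?exprn_ge0 ?(ltW c10) ?(ltW c20)//.
  by rewrite !powR_expn ?(ltW c10) ?(ltW c20).
have low e : 0 < e -> \forall n \near \oo, L - e < V n `^ ((w1 n + w2 n)%:R^-1).
  (* When the limit is 0 there may be no positive [c1 < D1] or [c2 < D2]; the lower estimate is then
     just the nonnegativity of powers. *)
  move=> e0; have [Le|Le] := leP L 0.
    by near=> n; apply: (@lt_le_trans _ _ 0); [lra|exact: powR_ge0].
  have [D1p D2p] : 0 < D1 /\ 0 < D2.
    case: hyp => // -[[DE th0]|[DE th0]]; move: Le; rewrite /L DE powR0 ?mul0r ?mulr0 ?ltxx//.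
      by rewrite gt_eqF.
    by rewrite gt_eqF// subr_gt0.
  (* The maximum with [1 / 2] keeps [s] positive for large [e], and [s >= 1 - e / (2 L)] gives
     [L s >= L - e / 2]. *)
  pose s := Num.max (1 / 2) (1 - e / (2 * L)).
  have s0 : 0 < s by rewrite /s lt_max; apply/orP; left; lra.
  have s1 : s < 1 by rewrite /s gt_max; apply/andP; split; [lra|rewrite gtrBl divr_gt0// mulr_gt0].
  have Ls : L - e < L * s.
    have : L * (1 - e / (2 * L)) <= L * s by rewrite ler_pM2l// /s le_max lexx orbT.
    apply: lt_le_trans.
    have -> : L * (1 - e / (2 * L)) = L - e / 2 by field; rewrite gt_eqF.
    lra.
  have c10 : 0 < D1 * s by rewrite mulr_gt0.
  have c20 : 0 < D2 * s by rewrite mulr_gt0.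
  have c1D : D1 * s < D1 by rewrite gtr_pMr.
  have c2D : D2 * s < D2 by rewrite gtr_pMr.
  have := cvgG _ _ c10 c20; rewrite powR_mean_scale// -/L.
  move=> /cvgr_gt/(_ _ Ls) Gn.
  near=> n; apply: (@lt_le_trans _ _ ((D1 * s) `^ ((w1 n)%:R / (w1 n + w2 n)%:R) *
     (D2 * s) `^ ((w2 n)%:R / (w1 n + w2 n)%:R))); first by near: n.
  have nN : (N < n)%N by near: n; exact: nbhs_infty_gt.
  have n0 : (0 < n)%N := leq_ltn_trans (leq0n N) nN.
  rewrite -rootG//; apply: ge0_ler_powR; rewrite ?invr_ge0 ?ler0n ?nnegrE//.
  - by rewrite mulr_ge0 ?exprn_ge0 ?(ltW c10) ?(ltW c20).
  - by have [] := hn _ nN.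
  - exact: lower.
have upp e : 0 < e -> \forall n \near \oo, V n `^ ((w1 n + w2 n)%:R^-1) < L + e.
  move=> e0; have [c1 [c2 [Dc1 Dc2 hc]]] := powR_mean_approx D10 D20 hyp e0.
  have c10 : 0 < c1 by apply: le_lt_trans Dc1.
  have c20 : 0 < c2 by apply: le_lt_trans Dc2.
  have [M M1 hM] := upper _ _ Dc1 Dc2.
  have := cvgM (factor_root_cvg K M) (cvgG _ _ c10 c20); rewrite mul1r => cvgH.
  have Gn := cvgr_lt _ (cvgH _) _ hc.
  near=> n; apply: (@le_lt_trans _ _ (expR (K * (ln K + ln M) / n%:R +
     4 * K * Num.sqrt (n%:R^-1)) * (c1 `^ ((w1 n)%:R / (w1 n + w2 n)%:R) *
     c2 `^ ((w2 n)%:R / (w1 n + w2 n)%:R)))); last by near: n; exact: Gn.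
  have nN : (N < n)%N by near: n; exact: nbhs_infty_gt.
  have n0 : (0 < n)%N := leq_ltn_trans (leq0n N) nN.
  have [V0 l0 dK ndK] := hn _ nN.
  have M0 : 0 < M := lt_le_trans ltr01 M1.
  have P0 : 0 <= c1 ^+ w1 n * c2 ^+ w2 n by rewrite mulr_ge0 ?exprn_ge0 ?(ltW c10) ?(ltW c20).
  have Q0 : 0 <= ((d n)`!)%:R * M ^+ d n by rewrite mulr_ge0 ?ler0n ?exprn_ge0 ?(ltW M0).
  apply: (@le_trans _ _ ((((d n)`!)%:R * M ^+ d n * (c1 ^+ w1 n * c2 ^+ w2 n)) `^
    ((w1 n + w2 n)%:R^-1))).
    apply: ge0_ler_powR; rewrite ?invr_ge0 ?ler0n ?nnegrE ?V0 ?(mulr_ge0 Q0 P0)//.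
    exact: hM.
  rewrite powRM// rootG// ler_wpM2r//; first by rewrite mulr_ge0 ?powR_ge0.
  exact: factor_root_le.
apply/cvgrPdist_lt => e e0; near=> n; rewrite distrC ltr_distl.
by apply/andP; split; near: n; [exact: low|exact: upp].
Unshelve. all: by end_near. Qed.
End RootSandwich.

(** * Suprema of Vandermonde determinants and the univariate diameter *)

Section TransfiniteDiameters.
Variable R : realType.
Implicit Types (E F : set R[i]).

(** [0 <= B] covers the empty image, whose [sup] is 0 by convention. *)
Lemma sup_image_le T (P : set T) (f : T -> R) B : 0 <= B ->
  (forall z, P z -> f z <= B) -> sup [set f z | z in P] <= B.
Proof.
move=> B0 fB; have [->|/set0P h0] := eqVneq [set f z | z in P] set0.
  by rewrite sup0.
by apply: ge_sup => // _ [z Pz <-]; exact: fB.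
Qed.

Lemma sup_image_ge T (P : set T) (f : T -> R) B z : 
  (forall z, P z -> f z <= B) -> P z -> f z <= sup [set f z | z in P].
Proof.
move=> fB Pz; apply: ub_le_sup; last by exists z.
by exists B => _ [y Py <-]; exact: fB.
Qed.

(** On sets that are empty or unbounded above, [sup] takes the default value 0. *)
Lemma sup_image_ge0 T (P : set T) (f : T -> R) :
  (forall z, 0 <= f z) -> 0 <= sup [set f z | z in P].
Proof.
move=> f0; set S := (X in sup X).
have [hs|/sup_out ->//] := pselect (has_sup S).
have [[_ [z Pz _]] ub] := hs.
by apply: le_trans (f0 z) _; apply: ub_le_sup => //; exists z.
Qed.

Section Multivariate.
Variables (E F : set R[i]) (d : nat -> nat).
Variable al : forall n, 'I_(d n) -> nat * nat.
Hypotheses (bE : cbounded E) (bF : cbounded F).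
Hypothesis ial : forall n, (0 < n)%N -> injective (@al n).
Hypothesis lal : forall n, (0 < n)%N -> lower_family (@al n).

Let vdm n (z : 'I_(d n) -> R[i] * R[i]) :=
  cmod (\det (\matrix_(i, j) ((z j).1 ^+ (al i).1 * (z j).2 ^+ (al i).2))).
Let V n := sup [set vdm z | z in
  [set z : 'I_(d n) -> R[i] * R[i] | forall j, E (z j).1 /\ F (z j).2]].
Let w1 n := (\sum_(i < d n) (al i).1)%N.
Let w2 n := (\sum_(i < d n) (al i).2)%N.

(** This is [root_sandwich] for the two Chebyshev constants. Stated for arbitrary families [al], it
    serves both the planar theorem and the univariate case. *)
Lemma vandermonde_root_cvg (th K : R) (N : nat) : 1 <= K ->
  (0 < cheb E /\ 0 < cheb F) \/ (cheb E = 0 /\ 0 < th) \/ (cheb F = 0 /\ th < 1) ->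
  (forall n, (N < n)%N -> [/\ (0 < w1 n + w2 n)%N,
     (d n)%:R <= K * n%:R ^+ 2 & n%:R * (d n)%:R <= K * (w1 n + w2 n)%:R]) ->
  ((w1 n)%:R / (w1 n + w2 n)%:R : R) @[n --> \oo] --> th ->
  V n `^ ((w1 n + w2 n)%:R^-1) @[n --> \oo] --> cheb E `^ th * cheb F `^ (1 - th).
Proof.
move=> K1 hyp hn w1th.
have VM c1 c2 : cheb E < c1 -> cheb F < c2 -> exists2 M, 1 <= M &
   forall n, (0 < n)%N -> forall z : 'I_(d n) -> R[i] * R[i],
   (forall j, E (z j).1 /\ F (z j).2) ->
   vdm z <= ((d n)`!)%:R * M ^+ d n * (c1 ^+ w1 n * c2 ^+ w2 n).
  move=> h1 h2; have [M M1 hM] := vandermonde_upper bE bF h1 h2.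
  by exists M => // n n0 z hz; exact: hM (ial n0) (lal n0) hz.
apply: (@root_sandwich _ V d w1 w2 _ _ _ K N) => //; rewrite ?cheb_ge0//.
- move=> n n0; have [l0 dK ndK] := hn _ n0; split=> //.
  by apply: sup_image_ge0 => z; exact: cmod_ge0.
- move=> c1 c2 c10 c20 h1 h2 n n0.
  have [z hz le_z] := vandermonde_lower c10 c20 h1 h2 (ial n0) (lal n0).
  apply: le_trans le_z _.
  (* A lower bound at one configuration passes to the supremum only if the values are bounded above;
     the upper estimate with any larger constants supplies this. *)
  have [//|//|M M1 hM] := VM (cheb E + 1) (cheb F + 1); rewrite ?ltrDl//.
  exact: (sup_image_ge (f := @vdm n) (hM n n0) hz).
- move=> c1 c2 h1 h2; have [M M1 hM] := VM _ _ h1 h2.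
  exists M => // n n0; apply: sup_image_le => [|z hz]; last exact: hM.
  have c10 : 0 <= c1 := le_trans (cheb_ge0 E) (ltW h1).
  have c20 : 0 <= c2 := le_trans (cheb_ge0 F) (ltW h2).
  by rewrite !mulr_ge0 ?exprn_ge0 ?ler0n// (le_trans ler01).
Qed.
End Multivariate.

(* The univariate case is the family of monomials [(i, 0)] on [E x E]. *)
Lemma Dtd_cheb E : cbounded E -> Dtd E = cheb E.
Proof.
move=> bE; rewrite /Dtd.
have w1E n : (\sum_(i < n.+1) i = 'C(n.+1, 2))%N by rewrite -bin2_sum big_mkord.
have h : VD E n `^ (('C(n.+1, 2))%:R^-1) @[n --> \oo] --> cheb E `^ 1 * cheb E `^ (1 - 1).
  have w2E n : (\sum_(i < n.+1) 0 = 0)%N by rewrite big1.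
  have VE n : VD E n = sup [set cmod (\det (\matrix_(i, j)
      ((z j).1 ^+ ((i : nat), 0%N).1 * (z j).2 ^+ ((i : nat), 0%N).2))) | z in
        [set z : 'I_n.+1 -> R[i] * R[i] | forall j, E (z j).1 /\ E (z j).2]].
    congr sup; apply/seteqP; split=> [_ [z hz <-]|_ [z hz <-]] /=.
      exists (fun j => (z j, z j)) => /=; first by move=> j; split.
      by congr (cmod (\det _)); apply/matrixP => i j; rewrite !mxE /= expr0 mulr1.
    exists (fun j => (z j).1) => /=; first by move=> j; case: (hz j).
    by congr (cmod (\det _)); apply/matrixP => i j; rewrite !mxE /= expr0 mulr1.
  have D : 0 < cheb E /\ 0 < cheb E \/ cheb E = 0 /\ 0 < 1 :> R \/ cheb E = 0 /\ 1 < 1 :> R.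
    have := cheb_ge0 E; rewrite le_eqVlt => /orP[/eqP <-|]; last by left.
    by right; left.
  (* [K = 4] and [N = 0] suffice: for [n > 0], [n + 1 <= 4 n^2], and [n (n + 1)] is twice the
     binomial coefficient. *)
  have := @vandermonde_root_cvg E E (fun n => n.+1) (fun n i => (val i, 0%N)) bE bE _ _ 1 4 0%N _ D.
  move=> H; apply: (cvg_trans _ (H _ _ _ _ _)) => {H}.
  - apply: near_eq_cvg; near=> n; rewrite /= w1E w2E addn0.
    by congr (_ `^ _); exact: esym (VE n).
  - by move=> n _ i j [/val_inj].
  - by move=> n _ i k1 k2 /= hk; rewrite leqn0 => /eqP ->;
      exists (Ordinal (leq_ltn_trans hk (ltn_ord i))).
  - by rewrite ler1n.
  - move=> n n0; rewrite w1E w2E addn0.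
    have c2 : ('C(n.+1, 2)).*2 = (n.+1 * n)%N by rewrite bin2 even_halfK// oddM/= andNb.
    split; first by rewrite bin_gt0.
      by rewrite -!natrX -!natrM ler_nat; nia.
    by rewrite -!natrM ler_nat; nia.
  - apply: (@cvg_trans _ ((1 : R) @[n --> \oo])); last exact: cvg_cst.
    apply: near_eq_cvg; near=> n.
    have n0 : (0 < n)%N by near: n; exact: nbhs_infty_gt.
    by rewrite w1E w2E addn0 divff// pnatr_eq0 -lt0n bin_gt0.
(* A zero exponent gives 1 for every base, including [cheb E = 0]. *)
have -> : cheb E = cheb E `^ 1 * cheb E `^ (1 - 1).
  by rewrite subrr powRr0 mulr1 powRr1 ?cheb_ge0.
by rewrite cvg_limn_supE; [exact: cvg_lim|apply: cvgP h].
Unshelve. all: by end_near. Qed.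

Lemma cmod_le_normD (z : R[i]) : cmod z <= `|complex.Re z| + `|complex.Im z|.
Proof.
rewrite -[leRHS]ger0_norm ?addr_ge0// -sqrtr_sqr ler_wsqrtr//.
rewrite sqrrD !real_normK ?num_real// addrAC lerDl mulrn_wge0//.
Qed.

Lemma ccompact_cbounded E : ccompact E -> cbounded E.
Proof.
move=> /(@compact_bounded _ (R^o * R^o)%type) [M [_ hM]].
(* The norm on pairs is the maximum of the coordinates, so the modulus costs a factor 2. *)
exists (2 * (`|M| + 1)); first by rewrite mulr_gt0// ltr_wpDl.
move=> x Ex; have M1 : M < `|M| + 1 by rewrite (le_lt_trans (ler_norm M))// ltrDl.
have : Num.max `|complex.Re x| `|complex.Im x| <= `|M| + 1.
  exact: hM _ M1 (complex.Re x, complex.Im x) (ex_intro2 _ _ x Ex erefl).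
rewrite ge_max => /andP[h1 h2].
by rewrite (le_trans (cmod_le_normD x))// mulr_natl lerD.
Qed.
End TransfiniteDiameters.

(** * The convex region as the set under a nonincreasing graph *)

Section RegionUnderGraph.
Variable R : realType.

(** Let [t] tend to 1. This extends bounds proved off the axes to points on them. *)
Lemma le_of_lt1_mul (x b : R) : (forall t, 0 < t < 1 -> t * x <= b) -> x <= b.
Proof.
move=> h; rewrite leNgt; apply/negP => bx.
have [b0|b0] := leP b 0.
  have [x0|x0] := leP x 0; last by have := h (1/2) ltac:(lra); lra.
  have x0' : x < 0 \/ x = 0 by move: x0; rewrite le_eqVlt => /orP[/eqP|]; auto.
  have := h (1/2) ltac:(lra).
  case: x0' => x0'; last by lra.
  by move=> _; have := h (1/2) ltac:(lra); nra.
have x0 : 0 < x by lra.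
have q0 : 0 < b / x by rewrite divr_gt0.
have q1 : b / x < 1 by rewrite ltr_pdivrMr// mul1r.
have := h ((b / x + 1) / 2) ltac:(lra).
have -> : (b / x + 1) / 2 * x = (b + x) / 2 by field; rewrite gt_eqF.
lra.
Qed.

(** [C] is a binary relation so that the section also applies to the transposed region, with [f] and
    [g] exchanged. *)
Variables (C : R -> R -> Prop) (a b : R) (f g : R -> R).
Hypothesis convC : forall x y x' y' t, C x y -> C x' y' -> 0 <= t <= 1 ->
  C (t * x + (1 - t) * x') (t * y + (1 - t) * y').
Hypothesis quadC : forall x y, C x y -> 0 <= x /\ 0 <= y.
Hypotheses (a0 : 0 < a) (b0 : 0 < b) (Cb : C b 0) (Ca : C 0 a) (C00 : C 0 0).
Hypothesis topC : forall x y, C x y ->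
  exists2 y', y <= y' & C x y' /\ forall e, 0 < e -> ~ C x (y' + e).
Hypothesis faceC : forall x y, 0 < x -> 0 < y -> C x y ->
  (forall e, 0 < e -> ~ C x (y + e)) ->
  [/\ 0 <= x <= b, y = f x, 0 <= y <= a & x = g y].
Hypothesis graph_f : forall x, 0 <= x <= b -> C x (f x).
Hypothesis graph_g : forall y, 0 <= y <= a ->
  [/\ C (g y) y, 0 <= g y <= b & y = f (g y)].

(** The top of the vertical slice through the point lies on both graphs. *)
Lemma region_pos x y : 0 < x -> 0 < y -> C x y -> [/\ x <= b, y <= f x & y <= a].
Proof.
move=> x0 y0 /topC[y' yy' [Cy' ny']].
have [/andP[_ xb] <- /andP[_ ya] _] := faceC x0 (lt_le_trans y0 yy') Cy' ny'.
by split => //; apply: le_trans ya.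
Qed.

(** [region_pos] needs a positive abscissa. Moving the point slightly towards [(b, 0)] provides
    one. *)
Lemma region_le_a x y : C x y -> y <= a.
Proof.
move=> Cxy; have [x0 y0] := quadC Cxy.
have [yp|yn] := ltP 0 y; last by rewrite (le_trans yn) ?ltW.
apply: le_of_lt1_mul => t /andP[t0 t1].
have Ct := convC Cxy Cb (t := t) ltac:(lra).
have [||_ _ h] := region_pos (x := t * x + (1 - t) * b) (y := t * y + (1 - t) * 0) _ _ Ct.
- have := mulr_ge0 (ltW t0) x0; have : 0 < (1 - t) * b by rewrite mulr_gt0 ?subr_gt0.
  lra.
- by rewrite mulr0 addr0 mulr_gt0.
- by move: h; rewrite mulr0 addr0.
Qed.

Lemma region_le_b x y : C x y -> x <= b.
Proof.
move=> Cxy; have [x0 y0] := quadC Cxy.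
have [xp|xn] := ltP 0 x; last by rewrite (le_trans xn) ?ltW.
apply: le_of_lt1_mul => t /andP[t0 t1].
have Ct := convC Cxy Ca (t := t) ltac:(lra).
have [||h _ _] := region_pos (x := t * x + (1 - t) * 0) (y := t * y + (1 - t) * a) _ _ Ct.
- by rewrite mulr0 addr0 mulr_gt0.
- have := mulr_ge0 (ltW t0) y0; have : 0 < (1 - t) * a by rewrite mulr_gt0 ?subr_gt0.
  lra.
- by move: h; rewrite mulr0 addr0.
Qed.

(* Otherwise [g a > 0] and the whole segment from [(0, a)] to [(g a, a)] lies in the face, which is then not a graph over the ordinate. *)
Lemma region_f0 : f 0 = a.
Proof.
have [|Cga /andP[ga0 gab] ga] := graph_g (y := a); first by rewrite lexx ltW.
have [gp|gn] := ltP 0 (g a); last first.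
  have g0 : g a = 0 by lra.
  by move: ga; rewrite g0 => <-.
have Ch := convC Cga Ca (t := 1 / 2) ltac:(lra).
have E : 1 / 2 * a + (1 - 1 / 2) * a = a by field.
rewrite E in Ch.
have [||_ _ _] := faceC _ a0 Ch _; first by lra.
  by move=> e e0 /region_le_a; lra.
lra.
Qed.

(** Forward, [x > 0] comes from [region_pos] and [x = 0] from [f 0 = a]. Backward, the vertical
    segment from [(x, 0)] to [(x, f x)] lies in [C] by convexity. *)
Lemma region_iff x y : C x y <-> 0 <= x <= b /\ 0 <= y <= f x.
Proof.
split=> [Cxy|[/andP[x0 xb] /andP[y0 yf]]].
  have [x0 y0] := quadC Cxy; have xb := region_le_b Cxy.
  rewrite x0 xb y0; split=> //.
  have [xp|xn] := ltP 0 x; last first.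
    have -> : x = 0 by lra.
    by rewrite region_f0; apply: region_le_a Cxy.
  have [yp|yn] := ltP 0 y; first by have [] := region_pos xp yp Cxy.
  by apply: le_trans yn _; apply: (quadC (graph_f _)).2; rewrite x0.
have Cx0 : C x 0.
  have := convC Cb C00 (t := x / b) _; rewrite !mulr0 !addr0 divfK ?gt_eqF//.
  by apply; rewrite divr_ge0 ?(ltW b0)// ler_pdivrMr// mul1r.
have Cxf : C x (f x) by apply: graph_f; rewrite x0.
have [yp|yn] := ltP 0 y; last by have -> : y = 0 by lra.
have fp : 0 < f x by lra.
have := convC Cxf Cx0 (t := y / f x) _; rewrite !mulr0 !addr0 divfK ?gt_eqF//.
have -> : y / f x * x + (1 - y / f x) * x = x by ring.
by apply; rewrite divr_ge0 ?(ltW fp)// ler_pdivrMr// mul1r.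
Qed.

(** The segment from [(0, a)] to [(x', f x')] has height at least [f x'] at abscissa [x], because
    [f x' <= a], and it stays under the graph. *)
Lemma region_noninc x x' : 0 <= x -> x <= x' -> x' <= b -> f x' <= f x.
Proof.
move=> x0 xx' xb; have [x'p|x'n] := ltP 0 x'; last first.
  by have -> : x = x' by lra.
have Cx' : C x' (f x') by apply: graph_f; rewrite xb andbT; lra.
have q0 : 0 <= x / x' by rewrite divr_ge0// ltW.
have q1 : x / x' <= 1 by rewrite ler_pdivrMr// mul1r.
have := convC Cx' Ca (t := x / x') _; rewrite q0 q1 => /(_ isT).
rewrite mulr0 addr0 divfK ?gt_eqF// => /region_iff[_ /andP[_]].
apply: le_trans; have := region_le_a Cx'; nra.
Qed.

(** The midpoint of [(b, 0)] and [(0, a)] lies under the graph. This makes the moment integral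
    positive. *)
Lemma region_fhalf : a / 2 <= f (b / 2).
Proof.
have := convC Cb Ca (t := 1 / 2) ltac:(lra).
have -> : 1 / 2 * b + (1 - 1 / 2) * 0 = b / 2 by field.
have -> : 1 / 2 * 0 + (1 - 1 / 2) * a = a / 2 by field.
by move=> /region_iff[_ /andP[_]].
Qed.

End RegionUnderGraph.

(** * Ends of slices and the outer face *)

Section OuterFace.
Variable R : realType.
Variable C : set (R * R).
Hypothesis clC : closed C.

Lemma closed_slice_sup (T : set R) B : closed T -> T !=set0 -> ubound T B -> T (sup T).
Proof.
move=> cT T0 ubT; apply: cT; apply: closure_sup => //; by exists B.
Qed.

Lemma slice_top B x y : (forall y, C (x, y) -> y <= B) -> C (x, y) ->
  exists2 y', y <= y' & C (x, y') /\ forall e, 0 < e -> ~ C (x, y' + e).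
Proof.
move=> hB Cxy; pose T := [set y | C (x, y)].
have ubT : ubound T B by move=> z; exact: hB.
have cT : closed T.
  by apply: (@preimage_closed _ _ (fun y => (x, y))) => // z _;
    apply: (cvg_pair (G := nbhs x) (H := nbhs z)); [exact: cvg_cst|exact: cvg_id].
have T0 : T !=set0 by exists y.
exists (sup T); first by apply: ub_le_sup => //; exists B.
split; first exact: (closed_slice_sup cT T0 ubT).
move=> e e0 h; have : sup T + e <= sup T by apply: ub_le_sup => //; exists B.
by lra.
Qed.

Lemma slice_right B x y : (forall x, C (x, y) -> x <= B) -> C (x, y) ->
  exists2 x', x <= x' & C (x', y) /\ forall e, 0 < e -> ~ C (x' + e, y).
Proof.
move=> hB Cxy; pose T := [set x | C (x, y)].
have ubT : ubound T B by move=> z; exact: hB.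
have cT : closed T.
  by apply: (@preimage_closed _ _ (fun x => (x, y))) => // z _;
    apply: (cvg_pair (G := nbhs z) (H := nbhs y)); [exact: cvg_id|exact: cvg_cst].
have T0 : T !=set0 by exists x.
exists (sup T); first by apply: ub_le_sup => //; exists B.
split; first exact: (closed_slice_sup cT T0 ubT).
move=> e e0 h; have : sup T + e <= sup T by apply: ub_le_sup => //; exists B.
by lra.
Qed.

Lemma outer_face_sub : outer_face C `<=` C.
Proof.
move=> p pC; apply: clC; apply: closureS pC => q [[]].
by rewrite -(closure_id _).1.
Qed.

Lemma outer_face_intro p : C p -> 0 < p.1 -> 0 < p.2 -> ~ interior C p -> outer_face C p.
Proof.
move=> Cp p1 p2 nip; apply: subset_closure; split; last by split; rewrite gt_eqF.
by split=> //; apply: subset_closure.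
Qed.

(** Read contrapositively: the upper or right end of a slice is not interior. *)
Lemma interior_extend p : interior C p ->
  exists2 e, 0 < e & C (p.1 + e, p.2) /\ C (p.1, p.2 + e).
Proof.
move=> /nbhs_ballP[e /= e0 he].
have e2 : `|- (e / 2)| < e by rewrite normrN gtr0_norm ?divr_gt0//; lra.
exists (e / 2); first by rewrite divr_gt0.
by split; apply: he; split; rewrite /= /ball/= ?subrr ?normr0// opprD addrA subrr add0r.
Qed.
End OuterFace.

(** * Moment integrals, Riemann sums and weighted lattice point counts *)

Section MomentIntegral.
Variable R : realType.
Variables (a b : R) (f : R -> R).
Hypothesis b0 : 0 < b.
Hypothesis f_ge0 : forall x : R, 0 <= x <= b -> 0 <= f x.
Hypothesis f_le : forall x : R, 0 <= x <= b -> f x <= a.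
Hypothesis f_noninc : forall x x' : R, 0 <= x -> x <= x' -> x' <= b -> f x' <= f x.

Let mu := @lebesgue_measure R.
Let moment x := Rintegral mu `[0, x] (fun u => u * f u).

Lemma measurable_moment : measurable_fun `[0, b] (fun u => u * f u).
Proof.
apply: measurable_funM; first exact: measurable_id.
(* [f] is monotone only on [[0, b]]; composing it with the clamp to this interval gives a function
   monotone on the whole line. *)
apply: (eq_measurable_fun (fun u : R => f (Num.min (Num.max u 0) b))).
  move=> u /set_mem; rewrite /= in_itv /= => /andP[u0 ub].
  by rewrite (max_idPl u0) (min_idPl ub).
apply: nonincreasing_measurable => // x y xy; apply: f_noninc.
- by rewrite le_min le_max lexx orbT ltW.
- by rewrite le_min2// ge_max !le_max lexx orbT xy.
- by rewrite ge_min lexx orbT.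
Qed.

Lemma integrable_moment : mu.-integrable `[0, b] (EFin \o (fun u => u * f u)).
Proof.
apply: measurable_bounded_integrable => //.
- by rewrite /mu /= lebesgue_measure_itv/=; case: ifP => _; rewrite ?ltry// -EFinB ltry.
- exact: measurable_moment.
- exists (b * a); split; rewrite ?num_real// => M bM u; rewrite /= in_itv /= => /andP[u0 ub].
  have fu : 0 <= f u by apply: f_ge0; rewrite u0.
  have fa : f u <= a by apply: f_le; rewrite u0.
  by rewrite ger0_norm ?mulr_ge0// (le_trans _ (ltW bM))// ler_pM.
Qed.

(** [u * f u] need not be monotone, so its factors are bounded separately: [x <= u <= y] and
    [f y <= f u <= f x]. *)
Lemma moment_bounds x y : 0 <= x -> x <= y -> y <= b ->
  (y - x) * (x * f y) <= moment y - moment x <= (y - x) * (y * f x).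
Proof.
move=> x0 xy yb.
have int_sub (D : set R) : measurable D -> D `<=` `[0, b] ->
    mu.-integrable D (EFin \o (fun u => u * f u)).
  by move=> mD Db; apply: integrableS integrable_moment.
have int_cst c : mu.-integrable `]x, y] (EFin \o (fun=> c : R)).
  apply: measurable_bounded_integrable => //.
  - by rewrite /mu /= lebesgue_measure_itv/=; case: ifP => _; rewrite ?ltry// -EFinB ltry.
  - by exists `|c|; split; rewrite ?num_real// => M cM u _ /=; exact: ltW.
have mxy c : \int[mu]_(u in `]x, y]) c = (y - x) * c.
  rewrite Rintegral_cst// /mu /= lebesgue_measure_itv/= lte_fin mulrC; congr (_ * _).
  by move: xy; rewrite le_eqVlt => /orP[/eqP ->|->//]; rewrite ltxx/= subrr.
have sub : `]x, y] `<=` `[0, b].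
  by move=> u; rewrite /= !in_itv/= => /andP[xu uy]; apply/andP; split; lra.
have -> : moment y - moment x = \int[mu]_(u in `]x, y]) (u * f u).
  rewrite /moment Rintegral_itvB//.
  by apply: int_sub => // u; rewrite /= !in_itv/= => /andP[xu uy]; apply/andP; split; lra.
rewrite -!mxy; apply/andP; split; apply: le_Rintegral => //; try exact: int_sub.
- move=> u; rewrite /= in_itv/= => /andP[xu uy]; apply: ler_pM => //.
  + by apply: f_ge0; apply/andP; split; lra.
  + by rewrite ltW.
  + by apply: f_noninc; lra.
- move=> u; rewrite /= in_itv/= => /andP[xu uy]; apply: ler_pM => //.
  + lra.
  + by apply: f_ge0; apply/andP; split; lra.
  + by apply: f_noninc; lra.
Qed.

Lemma moment0 : moment 0 = 0.
Proof. by rewrite /moment set_itv1 Rintegral_set1. Qed.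

Lemma moment_gt0 : 0 < f (b / 2) -> 0 < moment b.
Proof.
move=> fb.
have bp : 0 < b := b0.
have q1 : 0 <= b / 4 by rewrite divr_ge0 ?(ltW b0).
have q2 : b / 4 <= b / 2 by have := b0; lra.
have q3 : b / 2 <= b by have := b0; lra.
have q4 : 0 <= b / 2 := le_trans q1 q2.
have /andP[h1 _] := moment_bounds (lexx 0) q1 (le_trans q2 q3).
have /andP[h2 _] := moment_bounds q1 q2 q3.
have /andP[h3 _] := moment_bounds q4 q3 (lexx b).
have fb' : 0 <= f b by apply: f_ge0; rewrite lexx ltW.
(* Strict positivity comes from [[b / 4, b / 2]]: the lower bound is 0 on the first interval, whose
   left end is 0, and can be 0 on the last, where [f b] may vanish. *)
have : 0 < (b / 2 - b / 4) * (b / 4 * f (b / 2)) by apply: mulr_gt0; [lra|apply: mulr_gt0 => //; lra].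
have : 0 <= (b - b / 2) * (b / 2 * f b) by apply: mulr_ge0; [lra|apply: mulr_ge0 => //; lra].
by move: h1 h2 h3; rewrite moment0; lra.
Qed.

Variable n : nat.
Hypothesis n0 : (0 < n)%N.
Let G i := f (i%:R / n%:R).
Let n0' : 0 < n%:R :> R. Proof. by rewrite ltr0n. Qed.

(** Sum [moment_bounds] over intervals of length [1 / n]; [n^2] clears one denominator from the
    length and one from the abscissa. *)
Lemma moment_riemann k : k%:R / n%:R <= b ->
  \sum_(i < k) i%:R * G i.+1 <= n%:R ^+ 2 * moment (k%:R / n%:R) <=
  \sum_(i < k) i.+1%:R * G i.
Proof.
elim: k => [|k IH] kb; first by rewrite !big_ord0 mul0r moment0 mulr0 lexx.
have kk : k%:R / n%:R <= k.+1%:R / n%:R :> R by rewrite ler_pM2r ?invr_gt0// ler_nat.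
have /andP[IH1 IH2] := IH (le_trans kk kb).
have k0 : 0 <= k%:R / n%:R :> R by rewrite divr_ge0.
have /andP[] := moment_bounds k0 kk kb.
have dk : k.+1%:R / n%:R - k%:R / n%:R = n%:R^-1 :> R.
  by rewrite -mulrBl -natrB// subSnn mul1r.
rewrite dk -/(G k) -/(G k.+1) => h1 h2.
have n20 : 0 < n%:R ^+ 2 :> R by rewrite exprn_gt0.
rewrite !big_ord_recr/=.
have e (u v : R) : n%:R ^+ 2 * (n%:R^-1 * (u / n%:R * v)) = u * v.
  by field; rewrite gt_eqF.
rewrite -(ler_pM2l n20) e mulrBr in h1.
rewrite -(ler_pM2l n20) e mulrBr in h2.
by apply/andP; split; lra.
Qed.

Let m := Num.truncn (b * n%:R).

(** The lower and upper sums differ from the middle one by sums of values of [f], at most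
    [(m + 1) a]. The rest of the interval, from [m / n] to [b], is shorter than [1 / n] and is
    absorbed by the term [i = m] of the upper sum. *)
Lemma moment_riemann_error :
  `|\sum_(i < m.+1) i%:R * G i - n%:R ^+ 2 * moment b| <= m.+1%:R * a.
Proof.
have bn0 : 0 <= b * n%:R by rewrite mulr_ge0// ltW.
have /andP[mb bm] := Num.Theory.truncn_itv bn0; rewrite -/m in mb bm.
have mnb : m%:R / n%:R <= b by rewrite ler_pdivrMr.
have mn0 : 0 <= m%:R / n%:R :> R by rewrite divr_ge0.
have /andP[r1 r2] := moment_riemann mnb.
have /andP[t1 t2] := moment_bounds mn0 mnb (lexx b).
have G0 i : (i <= m)%N -> 0 <= G i <= a.
  move=> im; have ib : 0 <= (i%:R / n%:R : R) <= b.
    apply/andP; split; first exact: divr_ge0.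
    by apply: le_trans mnb; rewrite ler_pM2r ?invr_gt0// ler_nat.
  by rewrite f_ge0// f_le.
have n20 : 0 < n%:R ^+ 2 :> R by rewrite exprn_gt0.
have fb : 0 <= f b by apply: f_ge0; rewrite lexx ltW.
have T1 : 0 <= moment b - moment (m%:R / n%:R).
  by apply: le_trans t1; rewrite !mulr_ge0 ?subr_ge0.
have T2 : n%:R ^+ 2 * (moment b - moment (m%:R / n%:R)) <= m.+1%:R * G m.
  have /andP[Gm0 _] := G0 _ (leqnn m).
  apply: le_trans (_ : n%:R ^+ 2 * (n%:R^-1 * (m.+1%:R / n%:R * G m)) <= _); last first.
    by rewrite le_eqVlt; apply/orP; left; apply/eqP; field; rewrite gt_eqF.
  rewrite ler_pM2l//; apply: le_trans t2 _; apply: ler_pM; rewrite ?subr_ge0 ?mulr_ge0 ?(ltW b0)//.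
    have e : n%:R^-1 + m%:R / n%:R = m.+1%:R / n%:R :> R.
      by rewrite -natr1 mulrDl mul1r addrC.
    by rewrite lerBlDr e ler_pdivlMr// ltW.
  by rewrite ler_wpM2r// ler_pdivlMr// ltW.
have S1 : \sum_(i < m.+1) i.+1%:R * G i = \sum_(i < m.+1) i%:R * G i + \sum_(i < m.+1) G i.
  by rewrite -big_split; apply: eq_bigr => i _; rewrite -natr1 mulrDl mul1r.
have S2 : \sum_(i < m.+1) i%:R * G i = \sum_(i < m) i%:R * G i.+1 + \sum_(i < m) G i.+1.
  rewrite big_ord_recl mul0r add0r -big_split; apply: eq_bigr => i _.
  by rewrite lift0 -natr1 mulrDl mul1r.
have B1 : \sum_(i < m.+1) G i <= m.+1%:R * a.
  rewrite -[m.+1 in leRHS]card_ord mulr_natl -sumr_const.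
  by apply: ler_sum => i _; have /andP[] := G0 i (ltn_ord i).
have B2 : \sum_(i < m) G i.+1 <= m%:R * a.
  rewrite -[m in leRHS]card_ord mulr_natl -sumr_const.
  by apply: ler_sum => i _; have /andP[] := G0 i.+1 (ltn_ord i).
have a0 : 0 <= a by have /andP[] := G0 _ (leqnn m); apply: le_trans.
have ma : m%:R * a <= m.+1%:R * a by rewrite ler_wpM2r// ler_nat.
rewrite big_ord_recr/= in S1.
rewrite mulrBr in T2.
have T1' : 0 <= n%:R ^+ 2 * (moment b - moment (m%:R / n%:R)) by rewrite mulr_ge0// ltW.
rewrite mulrBr in T1'.
by rewrite ler_distl; apply/andP; split; lra.
Qed.

Variable P : nat -> nat -> bool.
Hypothesis PE : forall i j, P i j <->
  i%:R / n%:R <= b /\ j%:R / n%:R <= f (i%:R / n%:R).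

Let N2 := (Num.truncn (a * n%:R)).+1.

(** Column [i] consists of [j = 0, ..., t] with [t] the integer part of [n G i], so it has [t + 1]
    points. *)
Lemma column_count i : (i <= m)%N ->
  n%:R * G i <= (\sum_(j < N2 | P i j) 1)%:R /\
  (\sum_(j < N2 | P i j) 1)%:R <= n%:R * G i + 1 :> R.
Proof.
move=> im.
have bn0 : 0 <= b * n%:R by rewrite mulr_ge0// ltW.
have ib : i%:R / n%:R <= b by rewrite ler_pdivrMr// -truncn_ge_nat.
have ib0 : 0 <= (i%:R / n%:R : R) <= b by rewrite ib andbT divr_ge0.
have G0 : 0 <= n%:R * G i by rewrite mulr_ge0// f_ge0.
pose t := Num.truncn (n%:R * G i).
have PiE j : P i j = (j < t.+1)%N.
  rewrite ltnS truncn_ge_nat// [n%:R * _]mulrC -ler_pdivrMr//.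
  by apply/idP/idP => [/PE[]//|h]; apply/PE.
(* [f <= a] ensures that the range [j < N2] truncates no column. *)
have tN : (t.+1 <= N2)%N.
  by rewrite ltnS; apply: le_truncn; rewrite mulrC ler_pM2r// f_le.
rewrite (eq_bigl (fun j : 'I_N2 => (j < t.+1)%N)); last by move=> j; rewrite PiE.
rewrite -(@big_ord_widen _ _ _ t.+1 N2 (fun=> 1%N))// sum_nat_const card_ord muln1.
by have /andP[h1 h2] := truncn_itv G0; rewrite -/t in h1 h2; split; rewrite -?natr1; lra.
Qed.

(** Two errors of order [n^2] add up: rounding costs at most 1 per column, hence [(m + 1)^2] with
    the weights [i], and the Riemann sum costs [n (m + 1) a], where [m + 1 <= (b + 1) n]. *)
Lemma moment_count :
  `|(\sum_(i < m.+1) \sum_(j < N2 | P i j) i)%:R - n%:R ^+ 3 * moment b| <=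
  ((b + 1) ^+ 2 + (b + 1) * a) * n%:R ^+ 2.
Proof.
have bn0 : 0 <= b * n%:R by rewrite mulr_ge0// ltW.
have /andP[mb bm] := truncn_itv bn0; rewrite -/m in mb bm.
have n1 : 1 <= n%:R :> R by rewrite ler1n.
have m1 : m.+1%:R <= (b + 1) * n%:R by rewrite -natr1 mulrDl mul1r lerD.
have a0 : 0 <= a.
  by apply: le_trans (f_ge0 _) (f_le (x := 0) _); rewrite lexx ltW.
have := moment_riemann_error; set S := \sum_(i < m.+1) _ => err.
have WE : (\sum_(i < m.+1) \sum_(j < N2 | P i j) i)%:R =
    \sum_(i < m.+1) i%:R * (\sum_(j < N2 | P i j) 1)%:R :> R.
  rewrite natr_sum; apply: eq_bigr => i _; rewrite -natrM big_distrr/=.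
  by congr (_%:R); apply: eq_bigr => j _; rewrite muln1.
have W1 : n%:R * S <= \sum_(i < m.+1) i%:R * (\sum_(j < N2 | P i j) 1)%:R.
  rewrite mulr_sumr; apply: ler_sum => i _; rewrite mulrCA ler_wpM2l//.
  by have [] := column_count (ltn_ord i : (i <= m)%N).
have W2 : \sum_(i < m.+1) i%:R * (\sum_(j < N2 | P i j) 1)%:R <=
    n%:R * S + m.+1%:R ^+ 2.
  have -> : m.+1%:R ^+ 2 = \sum_(i < m.+1) m.+1%:R :> R.
    by rewrite sumr_const card_ord expr2 mulr_natl.
  rewrite mulr_sumr -big_split/=; apply: ler_sum => i _.
  have [_ h] := column_count (ltn_ord i : (i <= m)%N).
  have i0 : 0 <= i%:R :> R by [].
  apply: le_trans (ler_wpM2l i0 h) _; rewrite mulrDr mulr1 mulrCA lerD2l.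
  by rewrite ler_nat ltnW.
have m2 : m.+1%:R ^+ 2 <= (b + 1) ^+ 2 * n%:R ^+ 2.
  rewrite -exprMn; apply: lerXn2r => //; rewrite nnegrE//.
  by apply: mulr_ge0 => //; apply: addr_ge0 => //; exact: ltW.
have m3 : n%:R * (m.+1%:R * a) <= (b + 1) * a * n%:R ^+ 2.
  have -> : (b + 1) * a * n%:R ^+ 2 = n%:R * (((b + 1) * n%:R) * a) by ring.
  by rewrite ler_wpM2l// ler_wpM2r.
have n0'' : 0 <= n%:R :> R by [].
have : `|n%:R * S - n%:R ^+ 3 * moment b| <= n%:R * (m.+1%:R * a).
  by rewrite exprS -mulrA -mulrBr normrM (ger0_norm n0'') ler_wpM2l.
rewrite ler_distl => /andP[e1 e2].
rewrite WE ler_distl; apply/andP; split; lra.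
Qed.

End MomentIntegral.

(** * Enumeration of the lattice points of the dilated body *)

Section LatticePoints.
Variable R : realType.
Variables (C : set (R * R)) (n N1 N2 : nat).
Hypothesis CN : forall i j, in_nC C n (i, j) -> (i < N1)%N /\ (j < N2)%N.

(** [fset_set] reflects membership only for finite sets, so finiteness must come before any use of
    [idxC]. *)
Lemma in_nC_finite : finite_set [set J | in_nC C n J].
Proof.
apply: (@sub_finite_set _ _ (`I_N1 `*` `I_N2)); last exact: finite_setX.
by move=> [i j] /= /CN[].
Qed.

Lemma mem_idxC J : (J \in idxC C n) = `[< in_nC C n J >].
Proof. by rewrite in_fset_set//; exact: in_nC_finite. Qed.

Lemma alphaC_mem (i : 'I_(dC C n)) : in_nC C n (alphaC C n i).
Proof. by apply/asboolP; rewrite -mem_idxC; apply: mem_nth; exact: ltn_ord. Qed.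

Lemma alphaC_surj J : in_nC C n J -> exists i : 'I_(dC C n), alphaC C n i = J.
Proof.
move=> /asboolP; rewrite -mem_idxC => JC.
have h : (index J (enum_fset (idxC C n)) < dC C n)%N by rewrite index_mem.
by exists (Ordinal h); rewrite /alphaC /= nth_index.
Qed.

Lemma alphaC_inj : injective (fun i : 'I_(dC C n) => alphaC C n i).
Proof.
move=> i j /eqP; rewrite /alphaC nth_uniq ?fset_uniq//.
by move=> /eqP/val_inj.
Qed.

Lemma alphaC_lower : lower_set C -> (0 < n)%N ->
  lower_family (fun i : 'I_(dC C n) => alphaC C n i).
Proof.
move=> lowC n0 i k1 k2 h1 h2; apply: alphaC_surj.
have := alphaC_mem i; case: (alphaC C n i) h1 h2 => j1 j2 /= h1 h2 Cj.
exact: lowC n0 _ _ Cj _ _ h1 h2.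
Qed.

(** A sum ignores the order in which [idxC] is enumerated, so it can be arranged by columns inside
    the box [N1] by [N2]. *)
Lemma sum_alphaC (phi : nat * nat -> nat) :
  (\sum_(i < dC C n) phi (alphaC C n i) =
   \sum_(i < N1) \sum_(j < N2 | `[< in_nC C n (nat_of_ord i, nat_of_ord j) >])
     phi (nat_of_ord i, nat_of_ord j))%N.
Proof.
pose s := enum_fset (idxC C n).
transitivity (\sum_(J <- s) phi J)%N.
  by rewrite (big_nth (0%N, 0%N)) big_mkord.
pose r := [seq (i, j) | i <- iota 0 N1, j <- iota 0 N2].
have sr : perm_eq s [seq J <- r | `[< in_nC C n J >]].
  apply: uniq_perm; first exact: fset_uniq.
    by rewrite filter_uniq// allpairs_uniq ?iota_uniq// => -[? ?] [? ?].
  move=> [i j]; rewrite mem_filter -mem_idxC; symmetry; rewrite andb_idr//.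
  rewrite mem_idxC => /asboolP /CN[i1 j2].
  by apply/allpairsP; exists (i, j); rewrite !mem_iota.
rewrite (perm_big _ sr) big_filter big_mkcond big_allpairs/=.
rewrite -[N1 in iota _ N1]subn0 -/(index_iota 0 N1) big_mkord; apply: eq_bigr => i _.
by rewrite -[N2 in iota _ N2]subn0 -/(index_iota 0 N2) big_mkord [RHS]big_mkcond.
Qed.

End LatticePoints.

(** * Ratios of sequences with cubic growth *)

Section CubicGrowth.
Variable R : realType.

Lemma cvg_cubic (w : nat -> R) (A K : R) :
  (forall n, (0 < n)%N -> `|w n - n%:R ^+ 3 * A| <= K * n%:R ^+ 2) ->
  w n / n%:R ^+ 3 @[n --> \oo] --> A.
Proof.
move=> h.
have cK s : A + s * n%:R^-1 @[n --> \oo] --> A.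
  rewrite -[X in _ --> X]addr0 -[X in _ --> _ + X](mulr0 s).
  by apply: cvgD; [exact: cvg_cst|apply: cvgM; [exact: cvg_cst|exact: cvg_invn]].
apply: (squeeze_cvgr _ (cK (- K)) (cK K)); near=> n.
have n0 : (0 < n)%N by near: n; exact: nbhs_infty_gt.
have n0' : 0 < n%:R :> R by rewrite ltr0n.
have n3 : 0 < n%:R ^+ 3 :> R by rewrite exprn_gt0.
have := h _ n0; rewrite ler_distl => /andP[h1 h2].
have e s : (A + s * n%:R^-1) * n%:R ^+ 3 = n%:R ^+ 3 * A + s * n%:R ^+ 2.
  by field; rewrite gt_eqF.
by rewrite ler_pdivlMr// ler_pdivrMr// !e; apply/andP; split; lra.
Unshelve. all: by end_near. Qed.

Lemma cvg_cubic_ratio (w1 w2 : nat -> nat) (A B K1 K2 : R) : 0 < A + B ->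
  (forall n, (0 < n)%N -> `|(w1 n)%:R - n%:R ^+ 3 * A| <= K1 * n%:R ^+ 2) ->
  (forall n, (0 < n)%N -> `|(w2 n)%:R - n%:R ^+ 3 * B| <= K2 * n%:R ^+ 2) ->
  ((w1 n)%:R / (w1 n + w2 n)%:R : R) @[n --> \oo] --> A / (A + B).
Proof.
move=> AB0 h1 h2.
have c1 := cvg_cubic h1; have c2 := cvg_cubic h2.
apply: (@cvg_trans _ (((w1 n)%:R / n%:R ^+ 3) *
   ((w1 n)%:R / n%:R ^+ 3 + (w2 n)%:R / n%:R ^+ 3)^-1 @[n --> \oo])).
  apply: near_eq_cvg; near=> n.
  have n0 : (0 < n)%N by near: n; exact: nbhs_infty_gt.
  have n3 : n%:R ^+ 3 != 0 :> R by rewrite expf_neq0// pnatr_eq0 -lt0n.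
  move: (n%:R ^+ 3) n3 => t t0.
  by rewrite -mulrDl natrD invfM invrK mulrACA mulVf// mulr1.
apply: cvgM => //; apply: cvgV; first by rewrite gt_eqF.
exact: cvgD.
Unshelve. all: by end_near. Qed.
End CubicGrowth.

(** * Application to the body [C] and the product of [E] and [F] *)

Theorem theorem5p1 (R : realType) (C : set (R * R)) (eps delta a b : R)
    (f g : R -> R) (E F : set R[i]) :
  0 < eps -> eps < delta ->
  convex_body C -> C `<=` @quadrant R ->
  scale_set eps (@Sigma R) `<=` C -> C `<=` scale_set delta (@Sigma R) ->
  lower_set C ->
  0 < a -> 0 < b ->
  extreme_point C (b, 0) -> extreme_point C (0, a) ->
  outer_face C = [set (x, f x) | x in `[0, b]] ->
  outer_face C = [set (g y, y) | y in `[0, a]] ->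
  ccompact E -> ccompact F ->
  let A := Rintegral (@lebesgue_measure R) `[0, b] (fun u => u * f u) in
  let B := Rintegral (@lebesgue_measure R) `[0, a] (fun u => u * g u) in
  deltaC C (prodset E F) = Dtd E `^ (A / (A + B)) * Dtd F `^ (B / (A + B)) /\
  (A = B -> deltaC C (prodset E F) = (Dtd E * Dtd F) `^ 2^-1).
Proof.
move=> eps0 eps_delta [cptC [convC _]] quadC epsC Cdelta lowC a0 b0 [Cb _] [Ca _] facef faceg.
move=> cE cF A B.
have bE := ccompact_cbounded cE; have bF := ccompact_cbounded cF.
have clC : closed C by apply: compact_closed cptC; exact: (@norm_hausdorff _ (R^o * R^o)%type).
have C00 : C (0, 0).
  by apply: epsC; exists (0, 0); rewrite /= ?mulr0//; split; rewrite ?addr0.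
have delta0 : 0 < delta := lt_trans eps0 eps_delta.
have bound p : C p -> p.1 <= delta /\ p.2 <= delta.
  move=> /Cdelta[q [/= q1 [q2 q12]] <-] /=.
  by split; rewrite -[leRHS]mulr1 ler_pM2l//; lra.
have facefP x : 0 <= x <= b -> outer_face C (x, f x).
  by move=> xb; rewrite facef; exists x => //=; rewrite in_itv.
have facegP y : 0 <= y <= a -> outer_face C (g y, y).
  by move=> ya; rewrite faceg; exists y => //=; rewrite in_itv.
have face_f x y : outer_face C (x, y) -> 0 <= x <= b /\ y = f x.
  by rewrite facef => -[z]; rewrite /= in_itv => zb [<- <-].
have face_g x y : outer_face C (x, y) -> 0 <= y <= a /\ x = g y.
  by rewrite faceg => -[z]; rewrite /= in_itv => zb [<- <-].
have conv x y x' y' t : C (x, y) -> C (x', y') -> 0 <= t <= 1 ->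
  C (t * x + (1 - t) * x', t * y + (1 - t) * y').
  by move=> h1 h2 ht; have := convC _ _ _ h1 h2 ht.
have quad x y : C (x, y) -> 0 <= x /\ 0 <= y by move=> /quadC.
(* [Cs] is the transposed region: the lemmas on regions are used for [Cp] with [f] and for [Cs] with
   [g]. *)
pose Cp x y := C (x, y); pose Cs x y := C (y, x).
have top x y : Cp x y -> exists2 y', y <= y' & Cp x y' /\ forall e, 0 < e -> ~ Cp x (y' + e).
  by apply: (slice_top clC (B := delta)) => z /bound[].
have right x y : Cs x y -> exists2 y', y <= y' & Cs x y' /\ forall e, 0 < e -> ~ Cs x (y' + e).
  by apply: (slice_right clC (B := delta)) => z /bound[].
have hf x y : 0 < x -> 0 < y -> Cp x y -> (forall e, 0 < e -> ~ Cp x (y + e)) ->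
    [/\ 0 <= x <= b, y = f x, 0 <= y <= a & x = g y].
  (* A point that cannot be moved up inside [C] is not interior; off the axes it then lies on the
     outer face, hence on both graphs. *)
  move=> x0 y0 Cxy h; have O : outer_face C (x, y).
    by apply: outer_face_intro => // /interior_extend[e e0 [_]]; exact: h.
  by have [? ?] := face_f _ _ O; have [? ?] := face_g _ _ O.
have hg x y : 0 < x -> 0 < y -> Cs x y -> (forall e, 0 < e -> ~ Cs x (y + e)) ->
    [/\ 0 <= x <= a, y = g x, 0 <= y <= b & x = f y].
  move=> x0 y0 Cxy h; have O : outer_face C (y, x).
    by apply: outer_face_intro => // /interior_extend[e e0 [h' _]]; exact: h h'.
  by have [? ?] := face_f _ _ O; have [? ?] := face_g _ _ O.
have graph_f x : 0 <= x <= b -> [/\ Cs (f x) x, 0 <= f x <= a & x = g (f x)].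
  move=> xb; have O := facefP _ xb; have [? ?] := face_g _ _ O.
  by split => //; exact: outer_face_sub clC _ O.
have graph_g y : 0 <= y <= a -> [/\ Cp (g y) y, 0 <= g y <= b & y = f (g y)].
  move=> ya; have O := facegP _ ya; have [? ?] := face_f _ _ O.
  by split => //; exact: outer_face_sub clC _ O.
have graph_f' x : 0 <= x <= b -> Cp x (f x) by case/graph_f.
have graph_g' y : 0 <= y <= a -> Cs y (g y) by case/graph_g.
have convp x y x' y' t : Cp x y -> Cp x' y' -> 0 <= t <= 1 ->
  Cp (t * x + (1 - t) * x') (t * y + (1 - t) * y') := @conv x y x' y' t.
have convs x y x' y' t : Cs x y -> Cs x' y' -> 0 <= t <= 1 ->
  Cs (t * x + (1 - t) * x') (t * y + (1 - t) * y') := @conv y x y' x' t.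
have quads x y : Cs x y -> 0 <= x /\ 0 <= y by move=> /quad[].
have Rf := region_iff convp quad a0 b0 Cb Ca C00 top hf graph_f' graph_g.
have Rg := region_iff convs quads b0 a0 Ca Cb C00 right hg graph_g' graph_f.
have Mf := region_noninc convp quad a0 b0 Cb Ca C00 top hf graph_f' graph_g.
have Mg := region_noninc convs quads b0 a0 Ca Cb C00 right hg graph_g' graph_f.
have Hf := region_fhalf convp quad a0 b0 Cb Ca C00 top hf graph_f' graph_g.
have Hg := region_fhalf convs quads b0 a0 Ca Cb C00 right hg graph_g' graph_f.
have f0 x : 0 <= x <= b -> 0 <= f x by case/graph_f => _ /andP[].
have fa x : 0 <= x <= b -> f x <= a by case/graph_f => _ /andP[].
have g0 y : 0 <= y <= a -> 0 <= g y by case/graph_g => _ /andP[].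
have gb y : 0 <= y <= a -> g y <= b by case/graph_g => _ /andP[].
have A0 : 0 < A.
  by apply: (moment_gt0 b0 f0 fa Mf); apply: lt_le_trans Hf; rewrite divr_gt0.
have B0 : 0 < B.
  by apply: (moment_gt0 a0 g0 gb Mg); apply: lt_le_trans Hg; rewrite divr_gt0.
have AB0 : 0 < A + B by rewrite addr_gt0.
pose N1 n := (Num.truncn (b * n%:R)).+1.
pose N2 n := (Num.truncn (a * n%:R)).+1.
pose P n i j := `[< in_nC C n (i, j) >].
have PE n i j : P n i j <-> i%:R / n%:R <= b /\ j%:R / n%:R <= f (i%:R / n%:R).
  split=> [/asboolP/Rf[/andP[_ ?] /andP[_ ?]]//|[ib jf]].
  by apply/asboolP/Rf; rewrite ib jf !divr_ge0.
have PE' n i j : P n i j <-> j%:R / n%:R <= a /\ i%:R / n%:R <= g (j%:R / n%:R).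
  split=> [/asboolP/(Rg _ _).1[/andP[_ ?] /andP[_ ?]]//|[ja ig]].
  by apply/asboolP/(Rg _ _).2; rewrite ja ig !divr_ge0.
have CN n : (0 < n)%N -> forall i j, in_nC C n (i, j) -> (i < N1 n)%N /\ (j < N2 n)%N.
  move=> n0 i j /asboolP Pij; have n0' : 0 < n%:R :> R by rewrite ltr0n.
  have [ib _] := (PE n i j).1 Pij; have [ja _] := (PE' n i j).1 Pij.
  rewrite !ltnS !truncn_ge_nat ?mulr_ge0 ?(ltW a0) ?(ltW b0)//.
  by rewrite -!ler_pdivrMr.
pose w1 n := (\sum_(i < dC C n) (alphaC C n i).1)%N.
pose w2 n := (\sum_(i < dC C n) (alphaC C n i).2)%N.
have w1A n : (0 < n)%N -> `|(w1 n)%:R - n%:R ^+ 3 * A| <=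
    ((b + 1) ^+ 2 + (b + 1) * a) * n%:R ^+ 2.
  move=> n0; rewrite /w1 (sum_alphaC (CN n n0) (fun J => J.1)).
  exact: (@moment_count R a b f b0 f0 fa Mf n n0 (P n) (PE n)).
have w2B n : (0 < n)%N -> `|(w2 n)%:R - n%:R ^+ 3 * B| <=
    ((a + 1) ^+ 2 + (a + 1) * b) * n%:R ^+ 2.
  (* Exchanging the sums turns rows into columns, so the count for [g] yields [w2]. *)
  move=> n0; rewrite /w2 (sum_alphaC (CN n n0) (fun J => J.2)) (exchange_big_dep xpredT)//=.
  exact: (@moment_count R b a g a0 g0 gb Mg n n0 (fun j i => P n i j) (fun j i => PE' n i j)).
have dN n : (0 < n)%N -> (dC C n)%:R <= (b + 1) * (a + 1) * n%:R ^+ 2.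
  move=> n0; have n1 : 1 <= n%:R :> R by rewrite ler1n.
  have : (dC C n <= N1 n * N2 n)%N.
    have := sum_alphaC (CN n n0) (fun=> 1%N); rewrite sum_nat_const card_ord muln1 => ->.
    rewrite -[X in (_ <= X * _)%N]card_ord -sum_nat_const; apply: leq_sum => i _.
    have e : (\sum_(j < N2 n) 1 = N2 n)%N by rewrite sum_nat_const card_ord muln1.
    rewrite big_mkcond -[X in (_ <= X)%N]e.
    by apply: leq_sum => j _; case: ifP.
  rewrite -(ler_nat R) natrM => h; apply: le_trans h _.
  have Nle (c : R) : 0 < c -> (Num.truncn (c * n%:R)).+1%:R <= (c + 1) * n%:R.
    move=> c0; have cn : 0 <= c * n%:R by rewrite mulr_ge0// ltW.
    by have /andP[h _] := truncn_itv cn; rewrite -natr1; lra.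
  have -> : (b + 1) * (a + 1) * n%:R ^+ 2 = ((b + 1) * n%:R) * ((a + 1) * n%:R) by ring.
  by apply: ler_pM => //; exact: Nle.
pose K0 := (b + 1) ^+ 2 + (b + 1) * a + ((a + 1) ^+ 2 + (a + 1) * b).
pose K1 := (b + 1) * (a + 1).
have K10 : 0 < K1 by rewrite mulr_gt0// addr_gt0.
(* [K1] bounds [d_n / n^2], the factor [2 / (A + B)] comes from [l_n >= (A + B) n^3 / 2], and the
   summand 1 ensures [K >= 1]. *)
pose K := 1 + K1 + K1 * (2 / (A + B)).
(* Beyond [N] the total counting error [K0 n^2] is at most half of the main term [(A + B) n^3]. *)
pose N := Num.truncn (2 * K0 / (A + B)).
have K00 : 0 < K0 by rewrite !(addr_gt0, mulr_gt0, exprn_gt0).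
have lN n : (N < n)%N -> (A + B) / 2 * n%:R ^+ 3 <= (w1 n + w2 n)%:R.
  move=> Nn; have n0 : (0 < n)%N := leq_ltn_trans (leq0n N) Nn.
  have n0' : 0 < n%:R :> R by rewrite ltr0n.
  have := w1A n n0; have := w2B n n0; rewrite !ler_distl => /andP[h2 _] /andP[h1 _].
  have : 2 * K0 / (A + B) < n%:R.
    by rewrite -truncn_lt_nat// divr_ge0 ?(ltW AB0)// mulr_ge0 ?(ltW K00).
  rewrite ltr_pdivrMr// => hK.
  have : K0 * n%:R ^+ 2 <= (A + B) / 2 * n%:R ^+ 3.
    have -> : (A + B) / 2 * n%:R ^+ 3 = (n%:R * (A + B) / 2) * n%:R ^+ 2 by ring.
    by rewrite ler_wpM2r ?exprn_ge0//; lra.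
  rewrite natrD /K0; lra.
have growth n : (N < n)%N -> [/\ (0 < w1 n + w2 n)%N, (dC C n)%:R <= K * n%:R ^+ 2 &
    n%:R * (dC C n)%:R <= K * (w1 n + w2 n)%:R].
  move=> Nn; have n0 : (0 < n)%N := leq_ltn_trans (leq0n N) Nn.
  have n0' : 0 < n%:R :> R by rewrite ltr0n.
  have hl := lN n Nn; have hd := dN n n0.
  have q0 : 0 < 2 / (A + B) by rewrite divr_gt0.
  have l0 : 0 < (w1 n + w2 n)%:R :> R.
    by apply: lt_le_trans hl; rewrite mulr_gt0 ?divr_gt0 ?exprn_gt0.
  split.
  - by rewrite -(ltr_nat R).
  - apply: le_trans hd _; rewrite ler_wpM2r ?exprn_ge0// -/K1 /K.
    by have := mulr_gt0 K10 q0; lra.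
  - apply: le_trans (_ : K1 * (2 / (A + B)) * (w1 n + w2 n)%:R <= _); last first.
      by rewrite ler_wpM2r// /K; lra.
    rewrite [leLHS]mulrC.
    apply: le_trans (_ : K1 * n%:R ^+ 2 * n%:R <= _); first by rewrite ler_wpM2r.
    have -> : K1 * n%:R ^+ 2 * n%:R = K1 * (2 / (A + B)) * ((A + B) / 2 * n%:R ^+ 3).
      by field; rewrite gt_eqF.
    by rewrite ler_wpM2l// mulr_ge0 ?(ltW K10) ?(ltW q0).
have K1' : 1 <= K by rewrite /K; have := mulr_gt0 K10 (divr_gt0 (ltr0n R 2) AB0); lra.
have th0 : 0 < A / (A + B) by rewrite divr_gt0.
have th1 : A / (A + B) < 1 by rewrite ltr_pdivrMr// mul1r ltrDl.
have thB : 1 - A / (A + B) = B / (A + B).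
  by rewrite -{1}(divff (lt0r_neq0 AB0)) -mulrBl addrAC subrr add0r.
(* Both exponents lie strictly between 0 and 1, so a vanishing Chebyshev constant always falls under
   a degenerate alternative. *)
have hyp : 0 < cheb E /\ 0 < cheb F \/ cheb E = 0 /\ 0 < A / (A + B) \/
    cheb F = 0 /\ A / (A + B) < 1.
  have := cheb_ge0 E; rewrite le_eqVlt => /orP[/eqP <-|DE]; first by right; left.
  have := cheb_ge0 F; rewrite le_eqVlt => /orP[/eqP <-|DF]; first by right; right.
  by left.
have ial n : (0 < n)%N -> injective (fun i : 'I_(dC C n) => alphaC C n i).
  by move=> _; exact: alphaC_inj.
have lal n (n0 : (0 < n)%N) := alphaC_lower (CN n n0) lowC n0.
have limV := vandermonde_root_cvg bE bF ial lal K1' hyp growth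
  (cvg_cubic_ratio AB0 w1A w2B).
have lCE n : lC C n = (w1 n + w2 n)%N by rewrite /lC big_split.
have dE : deltaC C (prodset E F) = Dtd E `^ (A / (A + B)) * Dtd F `^ (B / (A + B)).
  rewrite !Dtd_cheb// -thB /deltaC.
  have h : VC C (prodset E F) n `^ ((lC C n)%:R^-1) @[n --> \oo] -->
      cheb E `^ (A / (A + B)) * cheb F `^ (1 - A / (A + B)).
    by under eq_fun do rewrite lCE; exact: limV.
  by rewrite cvg_limn_supE; [exact: cvg_lim|apply: cvgP h].
split=> // AB; rewrite dE -AB.
have -> : A / (A + A) = 2^-1 by rewrite -mulr2n -(mulr_natl A) invfM mulrCA mulfV ?mulr1 ?gt_eqF.
by rewrite powRM ?(Dtd_cheb bE) ?(Dtd_cheb bF) ?cheb_ge0.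
Qed.
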